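(* Let $T$ be an aperiodic tiling of $\mathbb{R}^d$ that is repetitive and has finite local complexity, and let $\Omega_T$ be its continuous hull. Then for any sufficiently large patch $P$ of $T$ (that is, there exists $R>0$ such that for every patch $P$ of $T$ whose union of tiles contains a ball of radius $R$), \[ \mathrm{Rank}(\mathrm{Ret}(P)) \le \mathrm{Rank}(\check H^1(\Omega_T)). \]
   Context: A tile is a closed topological ball in $\mathbb{R}^d$ that is the closure of its interior, possibly carrying a label; two tiles with the same label are translates of each other. A tiling of $\mathbb{R}^d$ is a collection of tiles with union $\mathbb{R}^d$ and pairwise disjoint interiors. A patch of a tiling is a (nonempty) finite subset of its tiles. The group $\mathbb{R}^d$ acts on tiles, patches and tilings by translation, leaving labels unchanged; the translate of $T$ by $x$ is written $T+x$. Patches that are translates of each other (with labels) are regarded as occurrences (copies) of the same patch. $T$ has finite local complexity (FLC) if for each $r>0$ there are only finitely many patches of $T$ of diameter at most $r$, up to translation. $T$ is aperiodic if $T+x=T$ implies $x=0$. $T$ is repetitive if for every patch $P$ of $T$ there is a radius $r(P)$ such that every ball of radius $r(P)$ contains at least one copy of $P$ in $T$. Tilings are topologized by the big ball metric: two tilings are $\epsilon$-close if they agree on a ball of radius $1/\epsilon$ around the origin, up to translating each by a distance at most $\epsilon/2$. The continuous hull $\Omega_T$ is the closure of the translation orbit $\{T+x : x\in\mathbb{R}^d\}$ in this topology. Given a patch $P$, fix a control point in $P$ and let $\{x_1,x_2,\ldots\}$ be the positions of the control point at all occurrences of $P$ in $T$ (the locations of $P$). The vectors $x_i-x_j$ are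 the return vectors of $P$ (they do not depend on the choice of control point). The return module $\mathrm{Ret}(P)$ is the additive subgroup of $\mathbb{R}^d$ generated over $\mathbb{Z}$ by the return vectors of $P$. The rank of an abelian group $G$ is $\dim_{\mathbb{Q}}(G\otimes\mathbb{Q})$. $\check H^1(\Omega_T)$ is the first Čech cohomology group of $\Omega_T$ with integer coefficients. *)

(* Defs.v *)
From HB Require Import structures.
From mathcomp Require Import all_boot all_order all_algebra.
From mathcomp Require Import ring lra.
From mathcomp Require Import all_classical all_reals all_analysis.
Import Order.TTheory GRing.Theory Num.Theory numFieldNormedType.Exports.

Set Implicit Arguments.
Unset Strict Implicit.
Unset Printing Implicit Defensive.

Local Open Scope classical_set_scope.
Local Open Scope ring_scope.
Local Open Scope quotient_scope.

Definition dmul (m n : nat) : nat := (m.+1 * n).-1.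
Arguments dmul : simpl never.

Lemma dmulE m n : (0 < n)%N -> (dmul m n).+1%:Z = m.+1%:Z * n%:Z.
Proof. by move=> n0; rewrite /dmul prednK ?muln_gt0. Qed.

Section TensQ.
Variable G : zmodType.

(* G ⊗ Q is built as the localization of G at the positive integers: the pair
   (g, n) stands for g ⊗ 1/(n+1).  Lemma [tensQ_universal] below shows that
   this is the tensor product over Z. *)
Definition tensQ_eq (p q : G * nat) : bool :=
  `[< exists k : nat,
        (p.1 *~ q.2.+1%:Z - q.1 *~ p.2.+1%:Z) *~ k.+1%:Z = 0 >].

Lemma tensQ_eq_refl : reflexive tensQ_eq.
Proof. by move=> p; apply/asboolP; exists 0%N; rewrite subrr mul0rz. Qed.

Lemma tensQ_eq_sym : symmetric tensQ_eq.
Proof.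
suff h p q : tensQ_eq p q -> tensQ_eq q p by move=> p q; apply/idP/idP; exact: h.
move=> /asboolP[k hk]; apply/asboolP; exists k.
by rewrite -opprB mulNrz hk oppr0.
Qed.

Lemma tensQ_eq_trans : transitive tensQ_eq.
Proof.
move=> q p s /asboolP[k hk] /asboolP[l hl]; apply/asboolP.
exists (q.2.+1 * k.+1 * l.+1).-1; rewrite dmulE//.
have -> : (p.1 *~ s.2.+1%:Z - s.1 *~ p.2.+1%:Z) *~ (q.2.+1 * k.+1 * l.+1)%:Z =
    ((p.1 *~ q.2.+1%:Z - q.1 *~ p.2.+1%:Z) *~ k.+1%:Z) *~ (s.2.+1%:Z * l.+1%:Z)
  + ((q.1 *~ s.2.+1%:Z - s.1 *~ q.2.+1%:Z) *~ l.+1%:Z) *~ (p.2.+1%:Z * k.+1%:Z).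
  rewrite !PoszM !mulrzBl -!mulrzA addrA.
  set a := q.1 *~ _; set b := q.1 *~ _.
  have -> : a = b by rewrite /a /b; congr (_ *~ _); ring.
  rewrite subrK; congr (_ *~ _ - _ *~ _); ring.
by rewrite hk hl !mul0rz addr0.
Qed.

Canonical tensQ_equiv := EquivRel tensQ_eq
  tensQ_eq_refl tensQ_eq_sym tensQ_eq_trans.

Definition tensQ := {eq_quot tensQ_equiv}.
HB.instance Definition _ := EqQuotient.on tensQ.
HB.instance Definition _ := Choice.on tensQ.

Lemma tensQ_piP (p q : G * nat) :
  (exists k : nat, (p.1 *~ q.2.+1%:Z - q.1 *~ p.2.+1%:Z) *~ k.+1%:Z = 0) <->
  \pi_tensQ p = \pi_tensQ q.
Proof.
split=> [h|/eqquotP/asboolP//].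
by apply/eqquotP/asboolP.
Qed.

Lemma tensQ_pi_eq (p q : G * nat) :
  p.1 *~ q.2.+1%:Z = q.1 *~ p.2.+1%:Z -> \pi_tensQ p = \pi_tensQ q.
Proof. by move=> h; apply/tensQ_piP; exists 0%N; rewrite h subrr mul0rz. Qed.

Definition tensQ_add (x y : tensQ) : tensQ :=
  let: (g, m) := repr x in let: (h, n) := repr y in
  \pi_tensQ (g *~ n.+1%:Z + h *~ m.+1%:Z, dmul m n.+1).

Definition tensQ_opp (x : tensQ) : tensQ :=
  let: (g, m) := repr x in \pi_tensQ (- g, m).

Definition tensQ_scale (a : rat) (x : tensQ) : tensQ :=
  let: (g, m) := repr x in
  \pi_tensQ (g *~ numq a, dmul m `|denq a|).

Lemma tensQ_addE g m h n : tensQ_add (\pi_tensQ (g, m)) (\pi_tensQ (h, n)) =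
  \pi_tensQ (g *~ n.+1%:Z + h *~ m.+1%:Z, dmul m n.+1).
Proof.
rewrite /tensQ_add.
case E : (repr _) => [g' m']; case F : (repr _) => [h' n'].
have /tensQ_piP[/= k hk] : \pi_tensQ (g', m') = \pi_tensQ (g, m).
  by rewrite -E reprK.
have /tensQ_piP[/= l hl] : \pi_tensQ (h', n') = \pi_tensQ (h, n).
  by rewrite -F reprK.
apply/tensQ_piP; exists (dmul k l.+1) => /=.
rewrite !dmulE//.
rewrite [X in X = _](_ : _ =
   ((g' *~ m.+1%:Z - g *~ m'.+1%:Z) *~ k.+1%:Z) *~
     (n.+1%:Z * n'.+1%:Z * l.+1%:Z)
 + ((h' *~ n.+1%:Z - h *~ n'.+1%:Z) *~ l.+1%:Z) *~
     (m.+1%:Z * m'.+1%:Z * k.+1%:Z)).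
  by rewrite hk hl !mul0rz addr0.
rewrite !mulrzBl !mulrzDl -!mulrzA opprD addrACA.
by congr (_ *~ _ - _ *~ _ + (_ *~ _ - _ *~ _)); ring.
Qed.

Lemma tensQ_oppE g m : tensQ_opp (\pi_tensQ (g, m)) = \pi_tensQ (- g, m).
Proof.
rewrite /tensQ_opp; case E : (repr _) => [g' m'].
have /tensQ_piP[/= k hk] : \pi_tensQ (g', m') = \pi_tensQ (g, m).
  by rewrite -E reprK.
apply/tensQ_piP; exists k => /=.
by rewrite !mulNrz -opprD mulNrz hk oppr0.
Qed.

Let denE (a : rat) : (`|denq a|%N : int) = denq a.
Proof. by rewrite absz_denq. Qed.

Let den_gt0 (a : rat) : (0 < `|denq a|)%N.
Proof. by rewrite absz_gt0 denq_neq0. Qed.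

Lemma tensQ_scaleE a g m : tensQ_scale a (\pi_tensQ (g, m)) =
  \pi_tensQ (g *~ numq a, dmul m `|denq a|).
Proof.
rewrite /tensQ_scale; case E : (repr _) => [g' m'].
have /tensQ_piP[/= k hk] : \pi_tensQ (g', m') = \pi_tensQ (g, m).
  by rewrite -E reprK.
apply/tensQ_piP; exists k => /=.
rewrite !dmulE ?den_gt0// denE.
rewrite [X in X = _](_ : _ = ((g' *~ m.+1%:Z - g *~ m'.+1%:Z) *~ k.+1%:Z) *~
     (numq a * denq a)); first by rewrite hk mul0rz.
rewrite !mulrzBl -!mulrzA.
by congr (_ *~ _ - _ *~ _); ring.
Qed.

Lemma tensQ_elim (Q : tensQ -> Prop) :
  (forall g m, Q (\pi_tensQ (g, m))) -> forall x, Q x.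
Proof. by move=> h x; rewrite -[x]reprK; case: (repr x). Qed.

Let addA : associative tensQ_add.
Proof.
elim/tensQ_elim => g m; elim/tensQ_elim => h n; elim/tensQ_elim => i p.
rewrite !tensQ_addE; apply: tensQ_pi_eq => /=.
rewrite !dmulE// !mulrzDl -!mulrzA addrA.
by congr (_ *~ _ + _ *~ _ + _ *~ _); ring.
Qed.

Let addC : commutative tensQ_add.
Proof.
elim/tensQ_elim => g m; elim/tensQ_elim => h n.
rewrite !tensQ_addE; apply: tensQ_pi_eq => /=.
by rewrite !dmulE// addrC; congr (_ *~ _); ring.
Qed.

Let add0 : left_id (\pi_tensQ (0, 0%N)) tensQ_add.
Proof.
elim/tensQ_elim => g m; rewrite tensQ_addE; apply: tensQ_pi_eq => /=.
by rewrite dmulE// mul0rz add0r -mulrzA; congr (_ *~ _); ring.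
Qed.

Let addN : left_inverse (\pi_tensQ (0, 0%N)) tensQ_opp tensQ_add.
Proof.
elim/tensQ_elim => g m; rewrite tensQ_oppE tensQ_addE; apply: tensQ_pi_eq => /=.
by rewrite mulNrz addNr !mul0rz.
Qed.

HB.instance Definition _ := GRing.isZmodule.Build tensQ addA addC add0 addN.

Let scaleA a b x : tensQ_scale a (tensQ_scale b x) = tensQ_scale (a * b) x.
Proof.
elim/tensQ_elim: x => g m; rewrite !tensQ_scaleE; apply: tensQ_pi_eq => /=.
rewrite !dmulE ?den_gt0// !denE -!mulrzA.
congr (_ *~ _).
have e : numq a * numq b * denq (a * b) = numq (a * b) * denq a * denq b.
  apply: (@intr_inj rat); rewrite !intrM.
  rewrite !numqE; ring.
by transitivity (m.+1%:Z * (numq a * numq b * denq (a * b))); [ring|rewrite e; ring].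
Qed.

Let scale1 x : tensQ_scale 1 x = x.
Proof.
elim/tensQ_elim: x => g m; rewrite !tensQ_scaleE; apply: tensQ_pi_eq => /=.
by rewrite dmulE// mulr1.
Qed.

Let scaleDr a : {morph tensQ_scale a : x y / x + y}.
Proof.
elim/tensQ_elim => g m; elim/tensQ_elim => h n.
rewrite [X in tensQ_scale _ X]tensQ_addE !tensQ_scaleE [RHS]tensQ_addE.
apply: tensQ_pi_eq => /=.
rewrite !dmulE ?den_gt0// !denE !mulrzDl -!mulrzA.
by congr (_ *~ _ + _ *~ _); ring.
Qed.

Let scaleDl x : {morph tensQ_scale^~ x : a b / a + b}.
Proof.
move=> a b; elim/tensQ_elim: x => g m.
rewrite !tensQ_scaleE [RHS]tensQ_addE; apply: tensQ_pi_eq => /=.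
rewrite !dmulE ?den_gt0// !denE -!mulrzA -mulrzDr -mulrzA.
congr (_ *~ _).
have e : numq (a + b) * denq a * denq b =
         (numq a * denq b + numq b * denq a) * denq (a + b).
  apply: (@intr_inj rat); rewrite !(intrM, intrD).
  rewrite !numqE; ring.
transitivity (m.+1%:Z * m.+1%:Z * (numq (a + b) * denq a * denq b)); first ring.
rewrite e; ring.
Qed.

HB.instance Definition _ := GRing.Zmodule_isLmodule.Build rat tensQ
  scaleA scale1 scaleDr scaleDl.

Definition tens (g : G) (a : rat) : tensQ := a *: \pi_tensQ (g, 0%N).

Lemma tensE g a : tens g a = \pi_tensQ (g *~ numq a, dmul 0 `|denq a|).
Proof. exact: tensQ_scaleE. Qed.

Lemma tens_pi g n : \pi_tensQ (g, n) = tens g (n.+1%:R^-1).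
Proof.
rewrite tensE; apply: tensQ_pi_eq => /=.
rewrite dmulE ?den_gt0// mul1r denE -mulrzA; congr (_ *~ _).
apply: (@intr_inj rat); rewrite intrM numqE.
by rewrite mulrAC mulVf ?mul1r// pnatr_eq0.
Qed.

Lemma tensDl g h a : tens (g + h) a = tens g a + tens h a.
Proof.
rewrite /tens -scalerDr; congr (_ *: _); rewrite [RHS]tensQ_addE.
by apply: tensQ_pi_eq; rewrite /= !mulr1z.
Qed.

Lemma tensDr g a b : tens g (a + b) = tens g a + tens g b.
Proof. exact: scalerDl. Qed.

Lemma tensQ_universal (M : zmodType) (b : G -> rat -> M) :
  (forall g h a, b (g + h) a = b g a + b h a) ->
  (forall g a a', b g (a + a') = b g a + b g a') ->
  exists! f : tensQ -> M,
    {morph f : x y / x + y} /\ forall g a, f (tens g a) = b g a.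
Proof.
move=> bl br.
pose bL a := fun g => b g a.
have b0l a : b 0 a = 0 by apply: (addrI (b 0 a)); rewrite -bl !addr0.
have b0r g : b g 0 = 0 by apply: (addrI (b g 0)); rewrite -br !addr0.
have bN g a : b (- g) a = - b g a.
  by apply/eqP; rewrite -subr_eq0 opprK -bl addNr b0l.
have bNr g a : b g (- a) = - b g a.
  by apply/eqP; rewrite -subr_eq0 opprK -br addNr b0r.
have bn g a n : b (g *+ n) a = b g (a *+ n).
  elim: n => [|n ih]; first by rewrite !mulr0n b0l b0r.
  by rewrite !mulrSr bl br ih.
have bz g a (z : int) : b (g *~ z) a = b g (a *~ z).
  case: z => n; first exact: bn.
  by rewrite !NegzE !mulrNz bN bNr -!pmulrn bn.
pose f (x : tensQ) : M := let: (g, n) := repr x in b g (n.+1%:R^-1).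
have fE g n : f (\pi_tensQ (g, n)) = b g (n.+1%:R^-1).
  rewrite /f; case E : (repr _) => [g' n'].
  have /tensQ_piP[/= k hk] : \pi_tensQ (g', n') = \pi_tensQ (g, n).
    by rewrite -E reprK.
  pose q : rat := (n.+1%:R * n'.+1%:R * k.+1%:R)^-1.
  have nz (j : nat) : j.+1%:R != 0 :> rat by rewrite pnatr_eq0.
  have h1 : b g' (n'.+1%:R^-1) = b (g' *~ n.+1%:Z *~ k.+1%:Z) q.
    rewrite !bz /q; congr b; rewrite -!mulrzA -mulrzr intrM -!pmulrn.
    move: n.+1%:R n'.+1%:R k.+1%:R (nz n) (nz n') (nz k) => x y z hx hy hz.
    by field; rewrite hx hy hz.
  have h2 : b g (n.+1%:R^-1) = b (g *~ n'.+1%:Z *~ k.+1%:Z) q.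
    rewrite !bz /q; congr b; rewrite -!mulrzA -mulrzr intrM -!pmulrn.
    move: n.+1%:R n'.+1%:R k.+1%:R (nz n) (nz n') (nz k) => x y z hx hy hz.
    by field; rewrite hx hy hz.
  rewrite h1 h2; congr b; apply/eqP; rewrite -subr_eq0; apply/eqP.
  by rewrite -mulrzBl.
have dR i j : (0 < j)%N -> (dmul i j).+1%:R = i.+1%:R * j%:R :> rat.
  by move=> j0; rewrite /dmul prednK ?muln_gt0// natrM.
exists f; split; first split.
- elim/tensQ_elim => g m; elim/tensQ_elim => h n.
  rewrite [X in f X]tensQ_addE !fE bl !bz dR//.
  have hm : m.+1%:R != 0 :> rat by rewrite pnatr_eq0.
  have hn : n.+1%:R != 0 :> rat by rewrite pnatr_eq0.
  by congr (b _ _ + b _ _); rewrite -mulrzr -pmulrn; move: m.+1%:R n.+1%:R hm hn => x y hx hy;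
    field; rewrite hx hy.
- move=> g a; rewrite tensE fE bz dR ?den_gt0// mul1r; congr b.
  rewrite -mulrzr [`|denq a|%:R](_ : _ = (denq a)%:~R); last first.
    by rewrite -[RHS]/((denq a)%:~R) -denE.
  by rewrite mulrC divq_num_den.
move=> f' [_ h]; apply/funext; elim/tensQ_elim => g n.
by rewrite fE tens_pi h.
Qed.

End TensQ.

Section Basis.
Variables (F : fieldType) (V : lmodType F).

Definition lin_indep (B : set V) := forall (s : seq V) (a : V -> F),
  uniq s -> (forall v, v \in s -> B v) ->
  \sum_(v <- s) a v *: v = 0 -> forall v, v \in s -> a v = 0.

Definition spanning (B : set V) := forall w : V,
  exists (s : seq V) (a : V -> F),
    (forall v, v \in s -> B v) /\ w = \sum_(v <- s) a v *: v.

Definition is_basis (B : set V) := lin_indep B /\ spanning B.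

End Basis.

(* Rank G <= Rank H, where the rank is the dimension over Q of G ⊗ Q, i.e. the
   (possibly infinite) cardinality of a basis; every vector space has a basis,
   and any two bases have the same cardinality. *)
Definition rank_le (G H : zmodType) : Prop :=
  exists (B : set (tensQ G)) (C : set (tensQ H)),
    [/\ is_basis B, is_basis C & (B #<= C)%card].

Section Zspan.
Variables (V : zmodType) (S : set V).

Definition zspan : set V :=
  smallest (fun A : set V => A 0 /\ forall x y, A x -> A y -> A (x - y)) S.

Definition zspan_pred : {pred V} := fun v => `[< zspan v >].

Lemma zspan_zmod_closed : zmod_closed zspan_pred.
Proof.
split=> [|x y /asboolP hx /asboolP hy].
  by apply/asboolP => A [[]].
by apply/asboolP => A h; apply: h.1.2; [exact: hx|exact: hy].
Qed.

HB.instance Definition _ :=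
  GRing.isZmodClosed.Build V zspan_pred zspan_zmod_closed.

Record zspan_group := ZspanGroup {
  zspan_val : V;
  _ : zspan_val \in zspan_pred }.

HB.instance Definition _ := [isSub for zspan_val].
HB.instance Definition _ := [Choice of zspan_group by <:].
HB.instance Definition _ := [SubChoice_isSubZmodule of zspan_group by <:].

End Zspan.

(* The direct limit, over the open covers of X ordered by refinement, of the
   first integral simplicial cohomology groups of their nerves.  A 1-cochain on
   the nerve of U is an integer function of the pairs (A, B) of members of U
   with nonempty intersection; it is represented by a total function whose
   other values are irrelevant. *)
Section Cech.
Variable X : topologicalType.
Implicit Types (U V W : set (set X)) (c : set X -> set X -> int).

Definition open_cover U :=
  (forall A, U A -> open A) /\ \bigcup_(A in U) A = [set: X].

Definition refinement V U (r : set X -> set X) :=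
  forall A, V A -> U (r A) /\ A `<=` r A.

Definition cocycle1 U c := forall A B C, U A -> U B -> U C ->
  A `&` B `&` C !=set0 -> c B C - c A C + c A B = 0.

Definition coboundary1 U c := exists h : set X -> int,
  forall A B, U A -> U B -> A `&` B !=set0 -> c A B = h B - h A.

Definition pullback (r : set X -> set X) c : set X -> set X -> int :=
  fun A B => c (r A) (r B).

Record cech_rep := CechRep {
  rep_cover : set (set X);
  rep_cochain : set X -> set X -> int;
  rep_coverP : open_cover rep_cover;
  rep_cocycle : cocycle1 rep_cover rep_cochain }.

HB.instance Definition _ := gen_eqMixin cech_rep.
HB.instance Definition _ := gen_choiceMixin cech_rep.

(* Equality in the direct limit: the two classes agree on some common
   refinement. *)
Definition cech_eq (p q : cech_rep) : bool :=
  `[< exists W (r s : set X -> set X),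
      [/\ open_cover W, refinement W (rep_cover p) r,
          refinement W (rep_cover q) s &
          coboundary1 W (fun A B => pullback r (rep_cochain p) A B -
                                    pullback s (rep_cochain q) A B)] >].

Lemma coboundary1D U c c' : coboundary1 U c -> coboundary1 U c' ->
  coboundary1 U (fun A B => c A B + c' A B).
Proof.
move=> [h H] [h' H']; exists (fun A => h A + h' A) => A B UA UB AB.
by rewrite H// H'//; ring.
Qed.

Lemma coboundary1N U c : coboundary1 U c -> coboundary1 U (fun A B => - c A B).
Proof.
move=> [h H]; exists (fun A => - h A) => A B UA UB AB.
by rewrite H//; ring.
Qed.

Lemma coboundary1_ext U c c' : (forall A B, c A B = c' A B) ->
  coboundary1 U c -> coboundary1 U c'.
Proof. by move=> e [h H]; exists h => A B *; rewrite -e H. Qed.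

Lemma coboundary1_pullback U V r c : refinement V U r ->
  coboundary1 U c -> coboundary1 V (pullback r c).
Proof.
move=> ref [h H]; exists (h \o r) => A B VA VB [x [Ax Bx]].
have [UA sA] := ref _ VA; have [UB sB] := ref _ VB.
by apply: H => //; exists x; split; [exact: sA|exact: sB].
Qed.

Lemma contiguous U V r s c : refinement V U r -> refinement V U s ->
  cocycle1 U c ->
  coboundary1 V (fun A B => pullback r c A B - pullback s c A B).
Proof.
move=> hr hs cc; exists (fun A => c (s A) (r A)) => A B VA VB [x [Ax Bx]].
have [rA1 rA2] := hr _ VA; have [rB1 rB2] := hr _ VB.
have [sA1 sA2] := hs _ VA; have [sB1 sB2] := hs _ VB.
have h1 : c (r A) (r B) - c (s A) (r B) + c (s A) (r A) = 0.
  by apply: cc => //; exists x; split; [split|]; auto.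
have h2 : c (s B) (r B) - c (s A) (r B) + c (s A) (s B) = 0.
  by apply: cc => //; exists x; split; [split|]; auto.
by rewrite /pullback; lra.
Qed.

Lemma refinement_comp U V W r s :
  refinement V U r -> refinement W V s -> refinement W U (r \o s).
Proof.
move=> hr hs A WA; have [VA sA] := hs _ WA; have [UA rA] := hr _ VA.
by split=> //= x /sA/rA.
Qed.

Definition meet_cover U V : set (set X) :=
  [set C | exists A B, [/\ U A, V B & C = A `&` B]].

Definition refine_to U (A : set X) : set X :=
  xget A [set B | U B /\ A `<=` B].

Lemma refine_toP U A : (exists2 B, U B & A `<=` B) ->
  U (refine_to U A) /\ A `<=` refine_to U A.
Proof.
move=> [B UB AB]; rewrite /refine_to.
by case: xgetP => [C _ //|/(_ B)[]].
Qed.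

Lemma open_cover_meet U V :
  open_cover U -> open_cover V -> open_cover (meet_cover U V).
Proof.
move=> [oU cU] [oV cV]; split=> [_ [A [B [UA VB ->]]]|].
  by apply: openI; [exact: oU|exact: oV].
apply/seteqP; split=> // x _.
have [A UA Ax] : (\bigcup_(A in U) A) x by rewrite cU.
have [B VB Bx] : (\bigcup_(A in V) A) x by rewrite cV.
by exists (A `&` B) => //; exists A, B.
Qed.

Lemma refine_meetl U V : refinement (meet_cover U V) U (refine_to U).
Proof.
move=> _ [A [B [UA VB ->]]]; apply: refine_toP.
by exists A => // x [].
Qed.

Lemma refine_meetr U V : refinement (meet_cover U V) V (refine_to V).
Proof.
move=> _ [A [B [UA VB ->]]]; apply: refine_toP.
by exists B => // x [].
Qed.

Lemma refinement_id U : refinement U U id. Proof. by move=> A UA; split. Qed.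

Lemma cocycle1_pullback U V r c : refinement V U r ->
  cocycle1 U c -> cocycle1 V (pullback r c).
Proof.
move=> ref cc A B C VA VB VC [x [[Ax Bx] Cx]].
have [UA sA] := ref _ VA; have [UB sB] := ref _ VB; have [UC sC] := ref _ VC.
by apply: cc => //; exists x; split; [split|]; auto.
Qed.

Lemma cech_eq_refl : reflexive cech_eq.
Proof.
move=> p; apply/asboolP; exists (rep_cover p), id, id.
split; [exact: rep_coverP|exact: refinement_id|exact: refinement_id|].
by exists (fun=> 0) => A B *; rewrite subrr.
Qed.

Lemma cech_eq_sym : symmetric cech_eq.
Proof.
suff h p q : cech_eq p q -> cech_eq q p by move=> p q; apply/idP/idP; exact: h.
move=> /asboolP[W [r [s [cW hr hs hc]]]]; apply/asboolP.
exists W, s, r; split=> //.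
by apply: coboundary1_ext (coboundary1N hc) => A B; rewrite opprB.
Qed.

Lemma cech_eq_trans : transitive cech_eq.
Proof.
move=> q p t /asboolP[W [r [s [cW hr hs hc]]]].
move=> /asboolP[W' [r' [s' [cW' hr' hs' hc']]]]; apply/asboolP.
pose m := refine_to W; pose m' := refine_to W'.
have hm : refinement (meet_cover W W') W m by exact: refine_meetl.
have hm' : refinement (meet_cover W W') W' m' by exact: refine_meetr.
exists (meet_cover W W'), (r \o m), (s' \o m'); split.
- exact: open_cover_meet.
- exact: refinement_comp hm.
- exact: refinement_comp hm'.
have h1 := coboundary1_pullback hm hc.
have h2 := coboundary1_pullback hm' hc'.
have h3 := contiguous (refinement_comp hs hm) (refinement_comp hr' hm')
  (@rep_cocycle q).
apply: coboundary1_ext (coboundary1D (coboundary1D h1 h3) h2) => A B.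
do !rewrite /pullback /=; ring.
Qed.

Canonical cech_equiv := EquivRel cech_eq cech_eq_refl cech_eq_sym cech_eq_trans.

Definition cech1 := {eq_quot cech_equiv}.
HB.instance Definition _ := Choice.on cech1.
HB.instance Definition _ := EqQuotient.on cech1.

Lemma cech_pi_eq p q W r s : open_cover W -> refinement W (rep_cover p) r ->
  refinement W (rep_cover q) s ->
  coboundary1 W (fun A B => pullback r (rep_cochain p) A B -
                            pullback s (rep_cochain q) A B) ->
  \pi_cech1 p = \pi_cech1 q.
Proof. by move=> *; apply/eqquotP/asboolP; exists W, r, s. Qed.

Lemma cech_add_cocycle (p q : cech_rep) :
  cocycle1 (meet_cover (rep_cover p) (rep_cover q))
    (fun A B => pullback (refine_to (rep_cover p)) (rep_cochain p) A B +
                pullback (refine_to (rep_cover q)) (rep_cochain q) A B).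
Proof.
move=> A B C hA hB hC hne.
have h1 := cocycle1_pullback (@refine_meetl _ (rep_cover q)) (@rep_cocycle p)
  hA hB hC hne.
have h2 := cocycle1_pullback (@refine_meetr (rep_cover p) _) (@rep_cocycle q)
  hA hB hC hne.
by lra.
Qed.

Definition cech_rep_add (p q : cech_rep) : cech_rep :=
  CechRep (open_cover_meet (rep_coverP p) (rep_coverP q))
          (@cech_add_cocycle p q).

Lemma cech_opp_cocycle (p : cech_rep) :
  cocycle1 (rep_cover p) (fun A B => - rep_cochain p A B).
Proof.
by move=> A B C hA hB hC hne; have := rep_cocycle hA hB hC hne; lra.
Qed.

Definition cech_rep_opp (p : cech_rep) : cech_rep :=
  CechRep (rep_coverP p) (@cech_opp_cocycle p).

Lemma open_coverT : open_cover [set [set: X]].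
Proof.
split=> [_ ->|]; first exact: openT.
by rewrite bigcup_set1.
Qed.

Lemma cocycle1_0 U : cocycle1 U (fun _ _ => 0).
Proof. by []. Qed.

Definition cech_rep0 : cech_rep := CechRep open_coverT (@cocycle1_0 _).

Definition cech_add (x y : cech1) : cech1 :=
  \pi_cech1 (cech_rep_add (repr x) (repr y)).
Definition cech_opp (x : cech1) : cech1 := \pi_cech1 (cech_rep_opp (repr x)).
Definition cech0 : cech1 := \pi_cech1 cech_rep0.

Lemma cech_addE p q :
  cech_add (\pi_cech1 p) (\pi_cech1 q) = \pi_cech1 (cech_rep_add p q).
Proof.
rewrite /cech_add.
have : \pi_cech1 (repr (\pi_cech1 p)) = \pi_cech1 p by rewrite reprK.
have : \pi_cech1 (repr (\pi_cech1 q)) = \pi_cech1 q by rewrite reprK.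
move: (repr _) (repr _) => p' q' /eqquotP/asboolP[W [r [s [cW hr hs hc]]]].
move=> /eqquotP/asboolP[W' [r' [s' [cW' hr' hs' hc']]]].
pose N := meet_cover (meet_cover W W')
  (meet_cover (rep_cover (cech_rep_add p' q')) (rep_cover (cech_rep_add p q))).
have nW : refinement N W (refine_to W \o refine_to (meet_cover W W')).
  exact: refinement_comp (@refine_meetl W W') (@refine_meetl _ _).
have nW' : refinement N W' (refine_to W' \o refine_to (meet_cover W W')).
  exact: refinement_comp (@refine_meetr W W') (@refine_meetl _ _).
have nR := refine_meetr (U := meet_cover W W') (V :=
 meet_cover (rep_cover (cech_rep_add p' q')) (rep_cover (cech_rep_add p q))).
have n1 := refinement_comp (@refine_meetl _ _) nR.
have n2 := refinement_comp (@refine_meetr _ _) nR.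
apply: (cech_pi_eq (W := N) _ n1 n2).
  apply: open_cover_meet; first exact: open_cover_meet.
  by apply: open_cover_meet; exact: rep_coverP.
have k1 := contiguous (refinement_comp (@refine_meetl _ _) n1)
  (refinement_comp hr' nW') (@rep_cocycle p').
have k2 := contiguous (refinement_comp hs' nW')
  (refinement_comp (@refine_meetl _ _) n2) (@rep_cocycle p).
have k3 := contiguous (refinement_comp (@refine_meetr _ _) n1)
  (refinement_comp hr nW) (@rep_cocycle q').
have k4 := contiguous (refinement_comp hs nW)
  (refinement_comp (@refine_meetr _ _) n2) (@rep_cocycle q).
have k5 := coboundary1_pullback nW hc.
have k6 := coboundary1_pullback nW' hc'.
apply: coboundary1_ext (coboundary1D (coboundary1D (coboundary1D k1 k6) k2)
                         (coboundary1D (coboundary1D k3 k5) k4)) => A B.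
do !rewrite /pullback /=; ring.
Qed.

Lemma cech_oppE p : cech_opp (\pi_cech1 p) = \pi_cech1 (cech_rep_opp p).
Proof.
rewrite /cech_opp.
have : \pi_cech1 (repr (\pi_cech1 p)) = \pi_cech1 p by rewrite reprK.
move: (repr _) => q /eqquotP/asboolP[W [r [s [cW hr hs hc]]]].
apply: (@cech_pi_eq (cech_rep_opp q) (cech_rep_opp p) _ _ _ cW hr hs).
by apply: coboundary1_ext (coboundary1N hc) => A B; do !rewrite /pullback /=; ring.
Qed.

Lemma cech_elim (Q : cech1 -> Prop) :
  (forall p, Q (\pi_cech1 p)) -> forall x, Q x.
Proof. by move=> h x; rewrite -[x]reprK. Qed.

Let addA : associative cech_add.
Proof.
elim/cech_elim => p; elim/cech_elim => q; elim/cech_elim => t.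
rewrite !cech_addE.
set L := cech_rep_add p _; set R := cech_rep_add _ t.
have nL := @refine_meetl (rep_cover L) (rep_cover R).
have nR := @refine_meetr (rep_cover L) (rep_cover R).
apply: (cech_pi_eq _ nL nR).
  by apply: open_cover_meet; exact: rep_coverP.
have Lq := refinement_comp (@refine_meetr _ _) nL.
have Rp := refinement_comp (@refine_meetl _ _) nR.
have k1 := contiguous (refinement_comp (@refine_meetl _ _) nL)
  (refinement_comp (@refine_meetl _ _) Rp) (@rep_cocycle p).
have k2 := contiguous (refinement_comp (@refine_meetl _ _) Lq)
  (refinement_comp (@refine_meetr _ _) Rp) (@rep_cocycle q).
have k3 := contiguous (refinement_comp (@refine_meetr _ _) Lq)
  (refinement_comp (@refine_meetr _ _) nR) (@rep_cocycle t).
apply: coboundary1_ext (coboundary1D (coboundary1D k1 k2) k3) => A B.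
do !rewrite /pullback /=; ring.
Qed.

Let addC : commutative cech_add.
Proof.
elim/cech_elim => p; elim/cech_elim => q; rewrite !cech_addE.
set L := cech_rep_add p q; set R := cech_rep_add q p.
have nL := @refine_meetl (rep_cover L) (rep_cover R).
have nR := @refine_meetr (rep_cover L) (rep_cover R).
apply: (cech_pi_eq _ nL nR).
  by apply: open_cover_meet; exact: rep_coverP.
have k1 := contiguous (refinement_comp (@refine_meetl _ _) nL)
  (refinement_comp (@refine_meetr _ _) nR) (@rep_cocycle p).
have k2 := contiguous (refinement_comp (@refine_meetr _ _) nL)
  (refinement_comp (@refine_meetl _ _) nR) (@rep_cocycle q).
apply: coboundary1_ext (coboundary1D k1 k2) => A B.
do !rewrite /pullback /=; ring.
Qed.

Let add0 : left_id cech0 cech_add.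
Proof.
elim/cech_elim => p; rewrite /cech0 cech_addE.
have n := @refine_meetr [set [set: X]] (rep_cover p).
apply: (@cech_pi_eq (cech_rep_add cech_rep0 p) p _ _ _ _
  (@refinement_id _) n); first exact: rep_coverP.
by exists (fun=> 0) => A B *; rewrite /pullback /= !(add0r, subrr).
Qed.

Let addN : left_inverse cech0 cech_opp cech_add.
Proof.
elim/cech_elim => p; rewrite cech_oppE cech_addE.
apply: (@cech_pi_eq (cech_rep_add (cech_rep_opp p) p) cech_rep0 _ _
  (fun=> setT) _ (@refinement_id _)); first exact: rep_coverP.
  by move=> A _; split.
exists (fun=> 0) => A B *; do !rewrite /pullback /=; ring.
Qed.

HB.instance Definition _ := GRing.isZmodule.Build cech1 addA addC add0 addN.

End Cech.

Section Euclid.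
Variables (R : realType) (d : nat).
Implicit Types x y : 'rV[R]_d.

(* The library norm on row vectors is the sup norm. *)
Definition enorm x : R := Num.sqrt (\sum_(i < d) x 0 i ^+ 2).

Definition eball (c : 'rV[R]_d) (r : R) : set 'rV[R]_d :=
  [set x | enorm (x - c) <= r].

Lemma enorm0 : enorm 0 = 0.
Proof. by rewrite /enorm big1 ?sqrtr0// => i _; rewrite mxE expr0n. Qed.

Lemma enormN x : enorm (- x) = enorm x.
Proof. by rewrite /enorm; congr Num.sqrt; apply: eq_bigr => i _; rewrite mxE sqrrN. Qed.

Lemma enormD x y : enorm (x + y) <= enorm x + enorm y.
Proof.
set A := \sum_(i < d) x 0 i ^+ 2.
set B := \sum_(i < d) y 0 i ^+ 2.
pose C := \sum_(i < d) x 0 i * y 0 i.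
have A0 : 0 <= A by apply: sumr_ge0 => i _; exact: sqr_ge0.
have B0 : 0 <= B by apply: sumr_ge0 => i _; exact: sqr_ge0.
have key a b : 0 <= a ^+ 2 * A - 2 * a * b * C + b ^+ 2 * B.
  rewrite /A /B /C !mulr_sumr -sumrB -big_split/=.
  apply: sumr_ge0 => i _.
  rewrite [X in 0 <= X](_ : _ = (a * x 0 i - b * y 0 i) ^+ 2) ?sqr_ge0//; ring.
have CS : C <= Num.sqrt A * Num.sqrt B.
  have [/eqP|/eqP A1] := eqVneq A 0.
    rewrite psumr_eq0 => [/allP x0|i _]; last exact: sqr_ge0.
    rewrite /C big1 ?mulr_ge0 ?sqrtr_ge0// => i _.
    have := x0 i; rewrite mem_index_enum => /(_ isT).
    by rewrite sqrf_eq0 => /eqP ->; rewrite mul0r.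
  have [C0|C0] := leP C 0.
    by rewrite (le_trans C0)// mulr_ge0 ?sqrtr_ge0.
  rewrite -sqrtrM// -[leLHS](ger0_norm (ltW C0)) -sqrtr_sqr ler_wsqrtr//.
  have Ap : 0 < A by rewrite lt_neqAle A0 eq_sym andbT; exact/eqP.
  have := key C A; rewrite [X in 0 <= X](_ : _ = A * (A * B - C ^+ 2)); last ring.
  by rewrite pmulr_rge0// subr_ge0.
rewrite -(ler_pXn2r (n := 2))// ?nnegrE ?addr_ge0 ?sqrtr_ge0//.
rewrite sqrrD !sqr_sqrtr//; last by apply: sumr_ge0 => i _; exact: sqr_ge0.
rewrite [leLHS](_ : _ = A + C *+ 2 + B); last first.
  rewrite /A /B /C mulr2n -!big_split/=; apply: eq_bigr => i _.
  by rewrite mxE; ring.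
by rewrite lerD2r lerD2l lerMn2r CS orbT.
Qed.

Definition topological_ball (A : set 'rV[R]_d) :=
  exists f g : 'rV[R]_d -> 'rV[R]_d,
    [/\ {within eball 0 1, continuous f}, {within A, continuous g},
        f @` eball 0 1 = A & forall x, eball 0 1 x -> g (f x) = x].

End Euclid.

Section Tiles.
Variables (R : realType) (d : nat) (L : Type).
Local Notation V := ('rV[R]_d).

(* [None] is the absence of a label: it does not force tiles to be translates of
   each other. *)
Definition tile : Type := set V * option L.

Definition is_tile (t : tile) := topological_ball t.1 /\ closure t.1^° = t.1.

Definition translate_tile (x : V) (t : tile) : tile := ([set y + x | y in t.1], t.2).
Definition translate (x : V) (P : set tile) : set tile := translate_tile x @` P.

Definition supp (P : set tile) : set V := \bigcup_(t in P) t.1.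

Definition is_tiling (T : set tile) :=
  [/\ forall t, T t -> is_tile t,
      supp T = [set: V],
      forall t u, T t -> T u -> t <> u -> t.1^° `&` u.1^° = set0 &
      forall t u l, T t -> T u -> t.2 = Some l -> u.2 = Some l ->
        exists x, u = translate_tile x t].

Record tiling := Tiling {
  tiles :> set tile;
  tilingP : is_tiling tiles }.

HB.instance Definition _ := gen_eqMixin tiling.
HB.instance Definition _ := gen_choiceMixin tiling.

Definition is_patch (T P : set tile) := [/\ finite_set P, P !=set0 & P `<=` T].

Definition diam_le (r : R) (A : set V) :=
  forall x y, A x -> A y -> enorm (x - y) <= r.

Definition FLC (T : set tile) := forall r : R, 0 < r ->
  exists F : set (set tile), finite_set F /\
    forall P, is_patch T P -> diam_le r (supp P) ->
      exists2 Q, F Q & exists x, P = translate x Q.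

Definition aperiodic (T : set tile) := forall x, translate x T = T -> x = 0.

Definition repetitive (T : set tile) := forall P, is_patch T P ->
  exists2 r : R, 0 < r & forall c, exists x,
    translate x P `<=` T /\ supp (translate x P) `<=` eball c r.

(* Agreement on a region means having the same tiles inside that region.  For
   tilings with tiles of bounded size, comparing the tiles that meet the region
   gives the same topology, since enlarging a ball by the maximal diameter of a
   tile exchanges the two conditions. *)
Definition agree_on (B : set V) (S T : set tile) :=
  forall t : tile, t.1 `<=` B -> (S t <-> T t).

Definition eps_close (e : R) (S T : set tile) := exists x y,
  [/\ enorm x <= e / 2, enorm y <= e / 2 &
      agree_on (eball 0 e^-1) (translate x S) (translate y T)].

Lemma translate_tileD x y t : translate_tile x (translate_tile y t) = translate_tile (y + x) t.
Proof.
case: t => A l; congr pair; apply/seteqP; split=> z /=.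
  by move=> [_ [a Aa <-] <-]; exists a; rewrite ?addrA.
by move=> [a Aa <-]; exists (a + y); rewrite ?addrA//; exists a.
Qed.

Lemma translate_tile0 t : translate_tile 0 t = t.
Proof.
case: t => A l; congr pair; apply/seteqP; split=> z /=.
  by move=> [a Aa <-]; rewrite addr0.
by move=> Az; exists z; rewrite ?addr0.
Qed.

Lemma in_translate x (P : set tile) t : translate x P t <-> P (translate_tile (- x) t).
Proof.
split=> [[u Pu <-]|Pt]; first by rewrite translate_tileD subrr translate_tile0.
by exists (translate_tile (- x) t) => //; rewrite translate_tileD addNr translate_tile0.
Qed.

Definition tiling_ent : set_system (tiling * tiling) :=
  [set A | exists2 e : R, 0 < e &
    [set ST : tiling * tiling | eps_close e ST.1 ST.2] `<=` A].

Lemma eps_close_le e e' (S T : set tile) :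
  0 < e -> e <= e' -> eps_close e S T -> eps_close e' S T.
Proof.
move=> e0 ee' [x [y [hx hy h]]]; exists x, y; split.
- by apply: le_trans hx _; rewrite ler_pM2r.
- by apply: le_trans hy _; rewrite ler_pM2r.
move=> t ht; apply: h => z /ht; rewrite /eball/= => /le_trans; apply.
by rewrite lef_pV2// posrE (lt_le_trans e0).
Qed.

Lemma eps_close_trans e (S T U : set tile) : 0 < e -> e <= 1 ->
  eps_close e S T -> eps_close e T U -> eps_close (e *+ 2) S U.
Proof.
move=> e0 e1 [x [y [hx hy h]]] [z [w [hz hw k]]].
have sub (v : V) t : enorm v <= e / 2 -> t.1 `<=` eball 0 (e *+ 2)^-1 ->
    (translate_tile v t).1 `<=` eball 0 e^-1.
  move=> hv ht _ [a /ht ha <-]; move: ha; rewrite /eball/= !subr0 => ha.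
  apply: le_trans (enormD _ _) _; apply: le_trans (lerD ha hv) _.
  have e11 : 1 <= e^-1 by rewrite invf_ge1.
  rewrite -mulr_natr invfM; lra.
exists (x - y), (w - z); split.
- apply: le_trans (enormD _ _) _; rewrite enormN; lra.
- apply: le_trans (enormD _ _) _; rewrite enormN; lra.
move=> t ht; rewrite !in_translate.
have hS : S (translate_tile (- (x - y)) t) <-> T t.
  have := h (translate_tile y t) (sub _ _ hy ht).
  by rewrite !in_translate !translate_tileD opprB subrr translate_tile0.
have hU : T t <-> U (translate_tile (- (w - z)) t).
  have := k (translate_tile z t) (sub _ _ hz ht).
  by rewrite !in_translate !translate_tileD opprB subrr translate_tile0.
exact: iff_trans hS hU.
Qed.

Lemma tiling_ent_filter : Filter tiling_ent.
Proof.
split.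
- by exists 1.
- move=> A B [e e0 hA] [f f0 hB]; exists (Num.min e f); first by rewrite lt_min e0.
  have m0 : 0 < Num.min e f by rewrite lt_min e0.
  move=> ST h; split.
    by apply: hA; apply: eps_close_le h => //; rewrite ge_min lexx.
  by apply: hB; apply: eps_close_le h => //; rewrite ge_min lexx orbT.
- by move=> A B AB [e e0 hA]; exists e => // ST /hA/AB.
Qed.

Lemma tiling_ent_diagonal A : tiling_ent A -> (diagonal `<=` A)%classic.
Proof.
move=> [e e0 hA] [S T] /diagonalP ST; apply: hA => /=; rewrite ST.
by exists 0, 0; rewrite enorm0; split=> //; rewrite divr_ge0// ltW.
Qed.

Lemma tiling_ent_inv A : tiling_ent A -> tiling_ent (A^-1)%relation.
Proof.
move=> [e e0 hA]; exists e => // -[S T] [x [y [hx hy h]]].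
by apply: hA; exists y, x; split=> // t ht; apply: iff_sym; exact: h.
Qed.

Lemma tiling_ent_split A : tiling_ent A ->
  exists2 B, tiling_ent B & (B \; B `<=` A)%relation.
Proof.
move=> [e e0 hA]; pose f := Num.min (e / 2) 1.
have f0 : 0 < f by rewrite lt_min divr_gt0/=.
exists [set ST : tiling * tiling | eps_close f ST.1 ST.2]; first by exists f.
move=> [S T] [U /= SU UT]; apply: hA.
apply: (@eps_close_le (f *+ 2)); first by rewrite mulrn_wgt0.
  have : f <= e / 2 by rewrite ge_min lexx.
  by rewrite -mulr_natr; lra.
by apply: eps_close_trans SU UT => //; rewrite ge_min lexx orbT.
Qed.

(* The relations eps_close e, for e > 0, generate the uniformity, hence the
   topology, of the big ball metric. *)
HB.instance Definition _ := isUniform.Build tiling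
  tiling_ent_filter tiling_ent_diagonal tiling_ent_inv tiling_ent_split.

Definition hull (T : tiling) : set tiling :=
  closure [set S : tiling | exists x, S = translate x T :> set tile].

(* The copy [translate x P] of P has its control point at c + x, where c is the
   control point of P; c cancels in the return vectors. *)
Definition locations (T P : set tile) : set V := [set x | translate x P `<=` T].

Definition return_vectors (T P : set tile) : set V :=
  [set v | exists x y, [/\ locations T P x, locations T P y & v = x - y]].

Definition Ret (T P : set tile) : zmodType := zspan_group (return_vectors T P).

End Tiles.

(* Main.v *)
Require Import Defs.
From HB Require Import structures.
From mathcomp Require Import all_boot all_order all_algebra.
From mathcomp Require Import ring lra finmap.
From mathcomp Require Import all_classical all_reals all_analysis.
Import Order.TTheory GRing.Theory Num.Theory numFieldNormedType.Exports.

Set Implicit Arguments.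
Unset Strict Implicit.
Unset Printing Implicit Defensive.

Local Open Scope classical_set_scope.
Local Open Scope ring_scope.
Local Open Scope quotient_scope.

(** Let P be a patch. An additive map phi from the return module of P to the
    integers gives a class in the first Cech cohomology of the hull: cover the
    hull by the sets of tilings that have an occurrence of P within eps of x,
    for x in a large ball; two such sets that meet at a tiling S determine two
    occurrences of P in S, at z and z', and the cocycle takes the value
    phi (z' - z). Short return vectors form a finite set by FLC, so for small
    eps the vector z' - z is the same for all S, and the cocycle identity is the
    additivity of phi ([displacementE], [occurrence_cocycle]).

    The assignment phi |-> class need not be injective. When the class of phi
    vanishes, a trivialisation on a refinement W gives an integer h A for each
    member A of W, and phi (z - z') is the difference of two values of h, where
    z and z' are occurrences of P in T. Along the orbit of T this makes phi,
    corrected by h, a locally constant function, hence a constant one; so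
    phi w = 0 for each w such that T - w lies in the same member of W as T. By
    FLC it is enough for this that a certain finite patch Q, which contains a
    copy of P, occurs at w ([patch_forcing_closeness]). Thus phi vanishes on the
    return module of the larger patch Q ([occurrence_class_eq0]).

    Return modules are finitely generated ([return_module_finitely_generated]),
    and they shrink when the patch grows. Hence there is a patch Q0 whose return
    module has the least rank n among all patches. For Q0 the map is injective:
    a phi in the kernel vanishes on a subgroup of the same rank n, so on a
    multiple of every element. The n coordinate functionals on the return module
    of Q0, scaled to take integer values, therefore have independent classes ([cech1_independent]), and the
    first cohomology group has rank at least n.

    Finally, by repetitivity every patch P whose support contains a sufficiently
    large ball contains a copy of Q0, so its return module embeds in that of Q0
    and has rank at most n. *)

(** * Integer linear independence and subgroups generated by a set *)

Section IntegerIndependence.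
Variable V : zmodType.
Implicit Types (S : set V) (g : V).

Definition zcomb n (v : 'I_n -> V) (k : 'I_n -> int) : V := \sum_i v i *~ k i.

Definition zindep n (v : 'I_n -> V) :=
  forall k, zcomb v k = 0 -> forall i, k i = 0.

Definition has_zindep (G : set V) n :=
  exists v : 'I_n -> V, (forall i, G (v i)) /\ zindep v.

Definition zgenerates m (E : 'I_m -> V) (G : set V) :=
  forall g, G g -> exists k, g = zcomb E k.

Lemma zcombB n (v : 'I_n -> V) k l :
  zcomb v (fun i => k i - l i) = zcomb v k - zcomb v l.
Proof. by rewrite /zcomb -sumrB/=; apply: eq_bigr => i _; rewrite mulrzBr. Qed.

Lemma zcombZ n (v : 'I_n -> V) (a : int) k :
  zcomb v (fun i => k i * a) = zcomb v k *~ a.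
Proof. by rewrite /zcomb mulrz_suml; apply: eq_bigr => i _; rewrite mulrzA. Qed.

Lemma zindep_inj n (v : 'I_n -> V) k l :
  zindep v -> zcomb v k = zcomb v l -> k =1 l.
Proof.
move=> vi e i; apply/eqP; rewrite -subr_eq0; apply/eqP.
by apply: (vi (fun i => k i - l i)); rewrite zcombB e subrr.
Qed.

Lemma zcomb_delta n (v : 'I_n -> V) (a : int) i :
  zcomb v (fun j => if j == i then a else 0) = v i *~ a.
Proof.
rewrite /zcomb (bigD1 i)//= eqxx big1 ?addr0// => j /negPf ->.
by rewrite mulr0z.
Qed.

Lemma common_denominator n (a : 'I_n -> rat) :
  exists N : int, N != 0 /\ exists k : 'I_n -> int, forall i, a i * N%:~R = (k i)%:~R.
Proof.
exists (\prod_i denq (a i)); split.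
  by apply/prodf_neq0 => i _; rewrite denq_neq0.
exists (fun i => numq (a i) * \prod_(j | j != i) denq (a j)) => i.
by rewrite (bigD1 i)//= !intrM mulrA numqE.
Qed.

(** An integer matrix with more rows than columns has a rational row vector in
    its left kernel; its denominators can be cleared. *)
Lemma int_left_kernel m n (A : 'I_n -> 'I_m -> int) : (m < n)%N ->
  exists k : 'I_n -> int, (exists i, k i != 0) /\ forall j, \sum_i k i * A i j = 0.
Proof.
move=> mn; pose M : 'M[rat]_(n, m) := \matrix_(i, j) (A i j)%:~R.
have kn0 : kermx M != 0.
  rewrite -mxrank_eq0 mxrank_ker -lt0n subn_gt0.
  by rewrite (leq_ltn_trans (rank_leq_col M)).
have /rowV0Pn[u /sub_kermxP uM u0] := kn0.
have [N [N0 [k kE]]] := common_denominator (u 0).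
exists k; split.
  have /existsP[i ui] : [exists i, u 0 i != 0].
    rewrite -negb_forall; apply: contra u0 => /forallP h.
    by apply/eqP/rowP => i; rewrite mxE; apply/eqP.
  by exists i; rewrite -(intr_eq0 rat) -kE mulf_neq0 ?intr_eq0.
move=> j; apply: (@intr_inj rat); rewrite rmorph_sum/=.
under eq_bigr do rewrite intrM -kE mulrAC.
rewrite -mulr_suml (eq_bigr (fun i => u 0 i * M i j)) => [|i _].
  by have := congr1 (fun B : 'rV_m => B 0 j) uM; rewrite !mxE => ->; rewrite mul0r.
by rewrite !mxE.
Qed.

Lemma zdep_of_gens m n (E : 'I_m -> V) (v : 'I_n -> V) : (m < n)%N ->
  (forall i, exists k, v i = zcomb E k) -> ~ zindep v.
Proof.
move=> mn /choice[A vA] vi; have [k [[i ki0] kA]] := int_left_kernel A mn.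
suff /vi/(_ i)/eqP : zcomb v k = 0 by rewrite (negPf ki0).
rewrite /zcomb; under eq_bigr do rewrite vA /zcomb mulrz_suml.
rewrite exchange_big/= big1// => j _.
under eq_bigr do rewrite -mulrzA mulrC.
by rewrite -mulrz_sumr kA mulr0z.
Qed.

Lemma zgenerates_bound m (E : 'I_m -> V) G n :
  zgenerates E G -> has_zindep G n -> (n <= m)%N.
Proof.
move=> EG [v [vG vi]]; rewrite leqNgt; apply/negP => mn.
by apply: zdep_of_gens mn _ vi => i; exact: EG.
Qed.

Lemma has_zindep_leq (G : set V) m n :
  (m <= n)%N -> has_zindep G n -> has_zindep G m.
Proof.
move=> /subnK <-; elim: (n - m)%N => // p ih; rewrite addSn.
move=> [v [vG vi]]; apply: ih; exists (fun i => v (lift ord0 i)); split=> // k k0 i.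
(* pad with a zero coefficient at the vector that was dropped *)
pose l j := if unlift ord0 j is Some i' then k i' else 0.
have lE j : l (lift ord0 j) = k j by rewrite /l liftK.
rewrite -lE; apply: vi; rewrite -[RHS]k0 /zcomb big_ord_recl.
rewrite {1}/l unlift_none mulr0z add0r.
by apply: eq_bigr => j _; rewrite lE.
Qed.

Lemma has_zindep0 (G : set V) : has_zindep G 0.
Proof. by exists (fun=> 0); split=> [[]|k _ []]. Qed.

(** Adding g to the family gives a nontrivial relation, in which the coefficient
    of g is nonzero because v is independent. *)
Lemma zindep_maximal n (v : 'I_n -> V) G g : (forall i, G (v i)) -> zindep v ->
  ~ has_zindep G n.+1 -> G g -> exists2 N : int, N != 0 & exists k, g *~ N = zcomb v k.
Proof.
move=> vG vi nG gG; apply: contrapT => h; apply: nG.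
pose w j := if unlift ord0 j is Some i then v i else g.
have w0 : w ord0 = g by rewrite /w unlift_none.
have wl i : w (lift ord0 i) = v i by rewrite /w liftK.
exists w; split.
  by move=> j; rewrite /w; case: unliftP => [i _|_].
move=> k; rewrite /zcomb big_ord_recl w0.
under eq_bigr do rewrite wl.
move=> e; have k0 : k ord0 = 0.
  apply: contrapT => /eqP kn0; apply: h; exists (k ord0) => //.
  exists (fun i => k (lift ord0 i) * -1); rewrite zcombZ mulrNz mulr1z.
  by apply/eqP; rewrite -subr_eq0 opprK; apply/eqP.
move=> j; case: (unliftP ord0 j) => [i ->|->//].
apply: (vi (fun i => k (lift ord0 i))).
by move: e; rewrite k0 mulr0z add0r.
Qed.

Section Span.
Variable S : set V.

Lemma zspan_ind (A : set V) : A 0 -> (forall x y, A x -> A y -> A (x - y)) ->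
  S `<=` A -> zspan S `<=` A.
Proof. by move=> A0 AB SA g; apply. Qed.

Lemma sub_zspan : S `<=` zspan S.
Proof. by move=> g Sg A [_]; apply. Qed.

Lemma zspanP g : reflect (zspan S g) (g \in zspan_pred S).
Proof. exact: asboolP. Qed.

Lemma zspan0 : zspan S 0.
Proof. by apply/zspanP; rewrite rpred0. Qed.

Lemma zspanB x y : zspan S x -> zspan S y -> zspan S (x - y).
Proof. by move=> /zspanP xS /zspanP yS; apply/zspanP; rewrite rpredB. Qed.

Lemma zspanD x y : zspan S x -> zspan S y -> zspan S (x + y).
Proof. by move=> /zspanP xS /zspanP yS; apply/zspanP; rewrite rpredD. Qed.

Lemma zspanMz x (a : int) : zspan S x -> zspan S (x *~ a).
Proof. by move=> /zspanP xS; apply/zspanP; rewrite rpredMz. Qed.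

End Span.

Lemma zspan_mono S S' : S `<=` zspan S' -> zspan S `<=` zspan S'.
Proof. by move=> SS'; apply: zspan_ind SS'; [exact: zspan0|exact: zspanB]. Qed.

Lemma zspan_seq_generated (s : seq V) :
  zgenerates (fun i : 'I_(size s) => s`_i) (zspan [set` s]).
Proof.
apply: zspan_ind.
- by exists (fun=> 0); rewrite /zcomb big1.
- by move=> _ _ [k ->] [l ->]; exists (fun i => k i - l i); rewrite zcombB.
- move=> g gs; have gs' : (index g s < size s)%N by rewrite index_mem.
  exists (fun j => if j == Ordinal gs' then 1 else 0).
  by rewrite zcomb_delta/= nth_index.
Qed.

Lemma zspan_fin_generated S (F : set V) : finite_set F -> S `<=` zspan F ->
  exists m (E : 'I_m -> V), zgenerates E (zspan S).
Proof.
move=> /finite_seqP[s ->] SF; exists (size s), (fun i : 'I_(size s) => s`_i).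
by move=> g gS; apply: zspan_seq_generated; apply: zspan_mono SF _ gS.
Qed.

(** Finite generation lets one integer N clear the denominators of all
    elements at once, so that the coordinates with respect to v / N are
    integers. *)
Lemma zspan_coordinates n (v : 'I_n -> V) S (s : seq V) :
  (forall g, g \in s -> zspan S g) -> S `<=` zspan [set` s] ->
  (forall i, zspan S (v i)) -> zindep v -> ~ has_zindep (zspan S) n.+1 ->
  exists2 N : int, N != 0 & forall g, zspan S g -> exists k, g *~ N = zcomb v k.
Proof.
move=> sS Ss vS vi nS.
have [N N0 hN] : exists2 N : int, N != 0 &
    forall g, g \in s -> exists k, g *~ N = zcomb v k.
  elim: s sS {Ss} => [|g s ih] sS; first by exists 1.
  have [|N N0 hN] := ih; first by move=> h hs; apply: sS; rewrite inE hs orbT.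
  have [|M M0 [k hM]] := zindep_maximal vS vi nS (g := g).
    by apply: sS; rewrite inE eqxx.
  exists (M * N) => [|h]; first by rewrite mulf_neq0.
  rewrite inE => /orP[/eqP ->|/hN[l hl]].
    by exists (fun i => k i * N); rewrite zcombZ -hM mulrzA.
  by exists (fun i => l i * M); rewrite zcombZ -hl -mulrzA mulrC.
exists N => // g /(zspan_mono Ss); move: g; apply: zspan_ind.
- by exists (fun=> 0); rewrite mul0rz /zcomb big1.
- move=> x y [k hk] [l hl]; exists (fun i => k i - l i).
  by rewrite zcombB -hk -hl mulrzBl.
- by move=> x; exact: hN.
Qed.

Lemma zspan_zcomb n (v : 'I_n -> V) S k : (forall i, zspan S (v i)) -> zspan S (zcomb v k).
Proof.
move=> vS; rewrite /zcomb; elim/big_ind: _ => [|x y|i _].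
- exact: zspan0.
- exact: zspanD.
- exact: zspanMz.
Qed.

End IntegerIndependence.

(** * Bases of vector spaces and comparison of ranks *)

Section Basis.
Variables (F : fieldType) (V : lmodType F).
Implicit Types (A B I : set V).

Lemma lin_indep_adjoin B w : lin_indep B ->
  ~ (exists (s : seq V) (a : V -> F),
       (forall v, v \in s -> B v) /\ w = \sum_(v <- s) a v *: v) ->
  lin_indep (B `|` [set w]).
Proof.
move=> iB nw s a us sB; have [ws|ws] := boolP (w \in s); last first.
  move=> /(iB s a us); apply => v vs.
  by case: (sB _ vs) => // vw; move: ws; rewrite -vw vs.
have rB v : v \in rem w s -> B v.
  rewrite mem_rem_uniq// inE => /andP[/= /eqP vw vs].
  by case: (sB _ vs).
rewrite (big_rem w)//= => e.
have aw0 : a w = 0.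
  apply: contrapT => /eqP awn0; apply: nw.
  exists (rem w s), (fun v => - (a w)^-1 * a v); split=> //.
  under eq_bigr do rewrite -scalerA.
  rewrite -scaler_sumr; move/eqP: e; rewrite addrC addr_eq0 => /eqP ->.
  by rewrite scalerN scaleNr opprK scalerA mulVf// scale1r.
move: e; rewrite aw0 scale0r add0r => /(iB _ _ (rem_uniq _ us) rB) h v vs.
have [->//|vw] := eqVneq v w.
by apply: h; rewrite mem_rem_uniq// inE vw.
Qed.

(** Zorn's lemma is applied to the sets A such that I together with A is
    independent, so that the empty chain is no exception. *)
Lemma basis_extension I : lin_indep I -> exists2 B, I `<=` B & is_basis B.
Proof.
move=> iI; have [C subC tot s a us sI|A [iA maxA]] := @Zorn_bigcup _ [set A | lin_indep (I `|` A)].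
  have [X XC sX] : exists2 X, X = set0 \/ C X & forall v, v \in s -> (I `|` X) v.
    elim: s sI {us} => [|v s ih] sI; first by exists set0; [left|].
    have [|X XC sX] := ih; first by move=> u us; apply: sI; rewrite inE us orbT.
    have ext Y : X `<=` Y -> (I `|` Y) v -> forall u, u \in v :: s -> (I `|` Y) u.
      move=> XY Yv u; rewrite inE => /orP[/eqP ->//|/sX[]]; first by left.
      by move=> /XY; right.
    have [Iv|[Y CY Yv]] := sI v (mem_head _ _).
      by exists X => //; apply: ext => //; left.
    have [X0|CX] := XC; first by exists Y; [right|apply: ext; [rewrite X0|right]].
    have [XY|YX] := tot _ _ CX CY.
      by exists Y; [right|apply: ext => //; right].
    by exists X; [right|apply: ext => //; right; exact: YX].
  have iX : lin_indep (I `|` X) by case: XC => [->|/subC//]; rewrite setU0.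
  exact: iX us sX.
exists (I `|` A); first by move=> x; left.
split=> // w; apply: contrapT => nw.
have wA : ~ A w.
  move=> Aw; apply: nw; exists [:: w], (fun=> 1); split.
    by move=> v; rewrite inE => /eqP ->; right.
  by rewrite big_seq1 scale1r.
apply: (maxA (A `|` [set w])); last by rewrite /= setUA; exact: lin_indep_adjoin.
split; first by move=> x; left.
by move=> /(_ w (or_intror erefl)).
Qed.

Lemma lin_indep_family m (b : 'I_m -> V) B (a : 'I_m -> F) :
  lin_indep B -> injective b -> (forall i, B (b i)) ->
  \sum_i a i *: b i = 0 -> forall i, a i = 0.
Proof.
move=> iB bi bB e i.
pose a' v := if [pick j | b j == v] is Some j then a j else 0.
have a'E j : a' (b j) = a j.
  by rewrite /a'; case: pickP => [k /eqP/bi->//|/(_ j)]; rewrite eqxx.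
rewrite -a'E; apply: (iB (map b (enum 'I_m))).
- by rewrite map_inj_uniq// enum_uniq.
- by move=> _ /mapP[j _ ->].
- rewrite big_map big_enum/= -[RHS]e; apply: eq_bigr => j _.
  by rewrite a'E.
- by rewrite mem_map ?mem_enum.
Qed.

Lemma lin_indep_range m (b : 'I_m -> V) :
  (forall a : 'I_m -> F, \sum_i a i *: b i = 0 -> forall i, a i = 0) ->
  injective b /\ lin_indep (range b).
Proof.
move=> ib; have bi : injective b.
  move=> i j bij; apply: contrapT => /eqP ij.
  have h : \sum_k ((k == i)%:R - (k == j)%:R) *: b k = 0.
    under eq_bigr do rewrite scalerBl.
    rewrite sumrB (bigD1 i)//= [X in _ - X](bigD1 j)//= !eqxx !scale1r bij.
    by rewrite !big1 ?addr0 ?subrr// => k /negPf ->; rewrite scale0r.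
  by have /eqP := ib _ h i; rewrite eqxx (negPf ij) subr0 oner_eq0.
split=> // s a us sb e v vs.
have [i _ iv] := sb v vs.
suff /(_ i) : forall i, (if b i \in s then a (b i) else 0) = 0 by rewrite iv vs.
apply: ib; rewrite -[RHS]e.
under eq_bigr do rewrite (fun_if (fun x => x *: _)) scale0r.
rewrite -big_mkcond/= -[LHS]big_filter -(big_map b xpredT (fun v => a v *: v)).
apply: perm_big; apply: uniq_perm => //.
  by rewrite map_inj_uniq// filter_uniq// /index_enum -enumT enum_uniq.
move=> u; apply/mapP/idP => [[j]|us'].
  by rewrite mem_filter => /andP[+ _] ->.
by have [j _ ju] := sb u us'; exists j => //; rewrite mem_filter ju us' mem_index_enum.
Qed.

End Basis.

Section Rank.

Lemma card_le_II_total T (B : set T) n : ~ (`I_n.+1 #<= B)%card -> (B #<= `I_n)%card.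
Proof.
move=> nB; have [/finite_setP[k Bk]|iB] := pselect (finite_set B); last first.
  by case: nB; apply: card_le_trans (iffLR (infiniteP _) iB); exact: card_leT.
rewrite (card_le_eql Bk) card_le_II leqNgt; apply/negP => nk; apply: nB.
by rewrite (card_le_eqr Bk) card_le_II.
Qed.

Lemma injective_card_le T m (b : 'I_m -> T) (C : set T) :
  injective b -> (forall i, C (b i)) -> (`I_m #<= C)%card.
Proof.
case: m b => [|m] b bi bC; first by rewrite II0 card_ge0.
have [f] : $|{injfun `I_m.+1 >-> C}|.
  apply/injfunPex; exists (fun i => b (inord i)); first by move=> i _; exact: bC.
  move=> i j; rewrite !inE/= => im jm /bi/(congr1 val).
  by rewrite /= !inordK.
exact: inj_card_le f.
Qed.

Lemma card_le_injective T m (B : set T) : (`I_m #<= B)%card ->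
  exists b : 'I_m -> T, injective b /\ forall i, B (b i).
Proof.
move=> /card_leP[f].
have iP (i : 'I_m) : val i \in `I_m by rewrite inE/=.
exists (fun i => set_val (f (SigSub (iP i)))); split.
  move=> i j /val_inj h; apply: val_inj.
  by have /(congr1 val) := @inj _ _ _ f _ _ (mem_setT _) (mem_setT _) h.
by move=> i; exact: set_valP.
Qed.

Variable G : zmodType.

Lemma tens_mulz (g : G) (k : int) : tens (g *~ k) 1 = k%:~R *: tens g 1.
Proof.
rewrite {2}/tens scalerA mulr1 -/(tens g _) !tensE numq_int denq_int.
by rewrite mulr1z.
Qed.

Lemma tens_zcomb n (v : 'I_n -> G) k :
  tens (zcomb v k) 1 = \sum_i (k i)%:~R *: tens (v i) 1.
Proof.
have t0 : tens (0 : G) 1 = 0.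
  by apply: (addrI (tens 0 1)); rewrite -tensDl !addr0.
rewrite /zcomb (big_morph (fun g => tens g 1) (fun x y => tensDl x y 1) t0).
by apply: eq_bigr => i _; rewrite tens_mulz.
Qed.

Lemma tens_eq0 (g : G) : tens g 1 = 0 -> exists2 k : int, k != 0 & g *~ k = 0.
Proof.
have -> : 0 = \pi_(tensQ G) (0, 0%N) by [].
rewrite tensE => /tensQ_piP[k /=]; rewrite mulr1z mul0rz subr0 mulr1z => h.
by exists k.+1.
Qed.

End Rank.

(** An integer relation among numerators gives a rational relation in the tensor
    product, and conversely up to torsion. So a basis of the tensor product of G
    with the rationals has at most n elements, and a basis of that of H has at
    least n. *)
Lemma rank_le_criterion (G H : zmodType) n :
  ~ has_zindep [set: G] n.+1 -> has_zindep [set: H] n -> rank_le G H.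
Proof.
move=> nG [c [_ ic]].
have [B _ bB] : exists2 B, set0 `<=` B & is_basis (B : set (tensQ G)).
  apply: basis_extension => s a _ s0 _ v /s0[].
have tc a : \sum_i a i *: tens (c i) 1 = 0 -> forall i, a i = 0.
  move=> e; have [N [N0 [k kE]]] := common_denominator a.
  have /tens_eq0[l l0 hl] : tens (zcomb c k) 1 = 0.
    rewrite tens_zcomb; under eq_bigr do rewrite -kE mulrC -scalerA.
    by rewrite -scaler_sumr e scaler0.
  move=> i; have /eqP : k i * l = 0 by apply: (ic (fun i => k i * l)); rewrite zcombZ.
  rewrite mulf_eq0 (negPf l0) orbF => /eqP ki.
  by have /eqP := kE i; rewrite ki mulf_eq0 intr_eq0 (negPf N0) orbF => /eqP.
have [tci tcl] := lin_indep_range tc.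
have [C cC bC] := basis_extension tcl.
exists B, C; split=> //; apply: (@card_le_trans _ _ _ `I_n); last first.
  by apply: injective_card_le tci _ => i; apply: cC; exists i.
apply: card_le_II_total => /(card_le_injective)[b [bi bb]].
have /choice[gm gmE] : forall i, exists gm, b i = \pi_(tensQ G) gm.
  by move=> i; exists (repr (b i)); rewrite reprK.
apply: nG; exists (fun i => (gm i).1); split=> // k e i.
suff /eqP : (k i)%:~R * (gm i).2.+1%:R = 0 :> rat.
  by rewrite mulf_eq0 pnatr_eq0 orbF intr_eq0 => /eqP.
apply: (lin_indep_family (a := fun i => (k i)%:~R * (gm i).2.+1%:R) bB.1 bi bb).
transitivity (tens (zcomb (fun i => (gm i).1) k) 1); last first.
  by rewrite e; apply: (addrI (tens 0 1)); rewrite -tensDl !addr0.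
rewrite tens_zcomb; apply: eq_bigr => j _; rewrite gmE.
by case: (gm j) => g m /=; rewrite tens_pi /tens !scalerA mulr1 -mulrA mulfV ?mulr1.
Qed.

(** * Cech classes of the cocycles of a fixed cover *)

Section CechClass.
Variables (X : topologicalType) (U : set (set X)) (coverU : open_cover U).
Implicit Types c : set X -> set X -> int.

(** The class is made total, with value 0 on the cochains that are not cocycles,
    so that it can be applied under a sum. *)
Definition cech_class c : cech1 X :=
  if pselect (cocycle1 U c) is left h then \pi_(cech1 X) (CechRep coverU h) else 0.

Lemma cech_classE c (h : cocycle1 U c) :
  cech_class c = \pi_(cech1 X) (CechRep coverU h).
Proof.
by rewrite /cech_class; case: pselect => // h'; rewrite (Prop_irrelevance h' h).
Qed.

Lemma cech_class_eq0 c : cocycle1 U c -> cech_class c = 0 ->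
  exists W r, [/\ open_cover W, refinement W U r & coboundary1 W (pullback r c)].
Proof.
move=> h; rewrite (cech_classE h) => /eqquotP/asboolP[W [r [s [cW hr _ hc]]]].
exists W, r; split=> //; apply: coboundary1_ext hc => A B.
by rewrite {2}/pullback /= subr0.
Qed.

Lemma cech_class_coboundary c : cocycle1 U c -> coboundary1 U c -> cech_class c = 0.
Proof.
move=> h hc; rewrite (cech_classE h).
apply: (cech_pi_eq (r := id) (s := fun=> setT) coverU).
- exact: refinement_id.
- by move=> A _.
by apply: coboundary1_ext hc => A B; rewrite /pullback /= subr0.
Qed.

Lemma cocycle1D c c' : cocycle1 U c -> cocycle1 U c' ->
  cocycle1 U (fun A B => c A B + c' A B).
Proof.
move=> h h' A B C UA UB UC ne.
by have := h A B C UA UB UC ne; have := h' A B C UA UB UC ne; lra.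
Qed.

Lemma cocycle1Z c k : cocycle1 U c -> cocycle1 U (fun A B => c A B * k).
Proof. by move=> h A B C UA UB UC ne; rewrite -mulrBl -mulrDl h// mul0r. Qed.

(** The sum in the direct limit is defined on the meet of U with itself, where
    the sum of the two cochains on U restricts to the same cochain. *)
Lemma cech_classD c c' : cocycle1 U c -> cocycle1 U c' ->
  cech_class (fun A B => c A B + c' A B) = cech_class c + cech_class c'.
Proof.
move=> h h'; rewrite (cech_classE h) (cech_classE h') (cech_classE (cocycle1D h h')).
rewrite [RHS]cech_addE; apply: (cech_pi_eq (W := meet_cover U U) 
  (r := refine_to U) (s := id)).
- exact: open_cover_meet.
- exact: refine_meetl.
- exact: refinement_id.
by exists (fun=> 0) => A B _ _ _; rewrite /pullback /= !subrr.
Qed.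

Lemma cech_classN c : cocycle1 U c ->
  cech_class (fun A B => c A B * -1) = - cech_class c.
Proof.
move=> h; apply/eqP; rewrite -addr_eq0 -cech_classD//; last exact: cocycle1Z.
rewrite cech_class_coboundary//; first exact/cocycle1D/h/cocycle1Z.
by exists (fun=> 0) => A B _ _ _; ring.
Qed.

Lemma cech_classZ c (k : int) : cocycle1 U c ->
  cech_class (fun A B => c A B * k) = cech_class c *~ k.
Proof.
move=> h; have nat_case (n : nat) : cech_class (fun A B => c A B * n%:Z) = cech_class c *+ n.
  elim: n => [|n ih].
    rewrite cech_class_coboundary ?mulr0n//; first exact: cocycle1Z.
    by exists (fun=> 0) => A B _ _ _; ring.
  rewrite mulrSr -ih -cech_classD//; last exact: cocycle1Z.
  by congr cech_class; apply/funext => A; apply/funext => B; rewrite intS; ring.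
case: k => n; first exact: nat_case.
rewrite NegzE mulrNz -pmulrn -nat_case -cech_classN; last exact: cocycle1Z.
by congr cech_class; apply/funext => A; apply/funext => B; ring.
Qed.

Lemma cech_class_zcomb n (c : 'I_n -> set X -> set X -> int) k :
  (forall i, cocycle1 U (c i)) ->
  zcomb (cech_class \o c) k = cech_class (fun A B => \sum_i c i A B * k i).
Proof.
move=> h; suff [_ //] : cocycle1 U (fun A B => \sum_i c i A B * k i) /\
    zcomb (cech_class \o c) k = cech_class (fun A B => \sum_i c i A B * k i).
rewrite /zcomb; elim: (index_enum _) => [|i s [ihc ih]].
  have z : (fun A B => \sum_(i <- [::]) c i A B * k i) = fun _ _ => 0.
    by apply/funext => A; apply/funext => B; rewrite big_nil.
  rewrite z big_nil; split=> //; rewrite cech_class_coboundary//.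
  by exists (fun=> 0).
have e : (fun A B => \sum_(j <- i :: s) c j A B * k j) =
    (fun A B => c i A B * k i + \sum_(j <- s) c j A B * k j).
  by apply/funext => A; apply/funext => B; rewrite big_cons.
rewrite e big_cons ih cech_classD//; last exact: cocycle1Z.
split; first exact/cocycle1D/ihc/cocycle1Z.
by rewrite cech_classZ.
Qed.

End CechClass.

(** * Topology of Euclidean space in terms of the Euclidean norm *)

Section EuclideanTopology.
Variables (R : realType) (d : nat).
Local Notation V := ('rV[R]_d).
Implicit Types (x y z v : V) (A : set V).

Lemma enorm_ge0 x : 0 <= enorm x. Proof. exact: sqrtr_ge0. Qed.

Lemma enormZ (a : R) x : enorm (a *: x) = `|a| * enorm x.
Proof.
rewrite /enorm -sqrtr_sqr -sqrtrM ?sqr_ge0// mulr_sumr; congr Num.sqrt.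
by apply: eq_bigr => i _; rewrite mxE exprMn.
Qed.

Lemma enormB x y : enorm (x - y) <= enorm x + enorm y.
Proof. by rewrite -(enormN y); exact: enormD. Qed.

Lemma enorm_distC x y : enorm (x - y) = enorm (y - x).
Proof. by rewrite -enormN opprB. Qed.

Lemma enormMn x (n : nat) : enorm (x *+ n) = enorm x *+ n.
Proof. by rewrite -scaler_nat enormZ normr_nat mulr_natl. Qed.

Lemma norm_le_enorm x : `|x| <= enorm x.
Proof.
rewrite [leLHS]/Num.Def.normr /= mx_normrE; apply/bigmax_leP; split=> [|[i j] _ /=].
  exact: enorm_ge0.
rewrite ord1 -sqrtr_sqr ler_wsqrtr// (bigD1 j)//= lerDl.
by apply: sumr_ge0 => k _; exact: sqr_ge0.
Qed.

Lemma enorm_le_norm x : enorm x <= Num.sqrt d%:R * `|x|.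
Proof.
rewrite -[X in _ * X]normr_id -sqrtr_sqr -sqrtrM// ler_wsqrtr//.
rewrite -[d in d%:R]card_ord mulr_natl -sumr_const; apply: ler_sum => i _.
rewrite -real_normK ?num_real// lerXn2r ?nnegrE//.
rewrite [leRHS]/Num.Def.normr /= mx_normrE.
by apply: (le_bigmax _ (fun ij : 'I_1 * 'I_d => `|x ij.1 ij.2|) (0, i)).
Qed.

Lemma enorm_eq0 x : enorm x = 0 -> x = 0.
Proof.
by move=> x0; apply/eqP; rewrite -normr_le0 -x0 norm_le_enorm.
Qed.

Lemma nbhs_enorm x A :
  nbhs x A <-> exists2 e, 0 < e & forall z, enorm (z - x) < e -> A z.
Proof.
split=> [/nbhs_ballP[e /= e0 eA]|[e e0 eA]].
  exists e => // z ze; apply: eA; rewrite -ball_normE /= distrC.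
  exact: le_lt_trans (norm_le_enorm _) ze.
have K0 : 0 < Num.sqrt d%:R + 1 :> R by rewrite ltr_wpDl ?sqrtr_ge0.
apply/nbhs_ballP; exists (e / (Num.sqrt d%:R + 1)); first exact: divr_gt0.
move=> z; rewrite -ball_normE /= distrC => ze; apply: eA.
apply: le_lt_trans (enorm_le_norm _) _.
apply: (@le_lt_trans _ _ ((Num.sqrt d%:R + 1) * `|z - x|)).
  by rewrite ler_wpM2r// lerDl.
by rewrite mulrC -ltr_pdivlMr.
Qed.

Lemma open_enorm_ball x (e : R) : open [set z | enorm (z - x) < e].
Proof.
rewrite openE => y /= ye; apply/nbhs_enorm; exists (e - enorm (y - x)).
  by rewrite subr_gt0.
move=> z /=; rewrite ltrBrDr => h; apply: le_lt_trans h.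
by apply: le_trans (enormD _ _); rewrite addrA subrK.
Qed.

Lemma compact_eball (r : R) : compact (eball (0 : V) r).
Proof.
apply: bounded_closed_compact.
  exists r; split; first exact: num_real.
  move=> M rM x; rewrite /eball/= subr0 => xr.
  exact: le_trans (norm_le_enorm _) (le_trans xr (ltW rM)).
rewrite -[eball _ _]setCK closedC openE => y.
rewrite /setC /eball /= subr0 => /negP; rewrite -ltNge => yr.
apply/nbhs_enorm; exists (enorm y - r); first by rewrite subr_gt0.
move=> z; rewrite ltrBrDl => h /=; apply/negP; rewrite -ltNge.
rewrite subr0 -(ltrD2r (enorm (z - y))); apply: lt_le_trans h _.
by apply: le_trans (enormB z _); rewrite opprB addrC subrK.
Qed.

Lemma eball_net (r e : R) : 0 < e -> exists2 N : set V, finite_set N &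
  forall x, enorm x <= r -> exists2 y, N y & enorm (x - y) < e.
Proof.
move=> e0; have := @compact_eball r; rewrite compact_cover.
move=> /(_ V setT (fun y => [set z | enorm (z - y) < e]))[| |D _ Dcov].
- by move=> y _; exact: open_enorm_ball.
- by move=> x _; exists x => //=; rewrite subrr enorm0.
exists [set` D]; first exact: finite_fset.
move=> x xr.
have [|y yD /= xy] := Dcov x; first by rewrite /eball/= subr0.
by exists y.
Qed.

Lemma compact_in_eball A : compact A -> exists r, A `<=` eball 0 r.
Proof.
move=> /compact_bounded[M [_ hM]]; exists (Num.sqrt d%:R * (M + 1)) => x /hM h.
rewrite /eball/= subr0; apply: le_trans (enorm_le_norm _) _.
by rewrite ler_wpM2l ?sqrtr_ge0//; apply: h; rewrite ltrDl.
Qed.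

(** On the segment from 0 to s, the points where F takes its value at 0 form an
    open and closed subset. *)
Lemma locally_constant_along_segments (F : V -> int) :
  (forall s, exists2 e, 0 < e & forall s', enorm (s' - s) < e -> F s' = F s) ->
  forall s, F s = F 0.
Proof.
move=> lc s.
have lcR (t : R) : exists2 e, 0 < e &
    forall t', `|t' - t| < e -> F (t' *: s) = F (t *: s).
  have [e e0 he] := lc (t *: s).
  have K0 : 0 < enorm s + 1 by rewrite ltr_wpDl ?enorm_ge0.
  exists (e / (enorm s + 1)) => [|t' ht]; first exact: divr_gt0.
  apply: he; rewrite -scalerBl enormZ.
  apply: (@le_lt_trans _ _ (`|t' - t| * (enorm s + 1))).
    by rewrite ler_wpM2l// lerDl.
  by rewrite -ltr_pdivlMr.
have op (P : int -> Prop) : open [set t : R | P (F (t *: s))].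
  rewrite openE => t /= Pt; have [e e0 he] := lcR t.
  apply/nbhs_ballP; exists e => // t'; rewrite /ball/= distrC => ht.
  by rewrite /= he.
have : `[0 : R, 1]%classic `&` [set t | F (t *: s) = F 0] = `[0 : R, 1]%classic.
  apply: (@segment_connected R 0 1).
  - by exists 0; split; rewrite /= ?in_itv/= ?lexx ?ler01// scale0r.
  - by exists [set t | F (t *: s) = F 0]; first exact: (op (fun k => k = F 0)).
  - exists [set t | F (t *: s) = F 0] => //.
    by rewrite -[X in closed X]setCK closedC; exact: (op (fun k => ~ (k = F 0))).
move=> /seteqP[_ /(_ 1)]; rewrite /= in_itv/= lexx ler01 scale1r.
by move=> /(_ isT)[].
Qed.

Lemma interior_enormP A x :
  A^° x <-> exists2 e, 0 < e & forall z, enorm (z - x) < e -> A z.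
Proof. exact: nbhs_enorm. Qed.

Lemma closure_enormP A x :
  closure A x <-> forall e, 0 < e -> exists2 y, A y & enorm (y - x) < e.
Proof.
split=> [h e e0|h B /nbhs_enorm[e e0 eB]].
  have /h[y [Ay By]] : nbhs x [set y | enorm (y - x) < e].
    by apply/nbhs_enorm; exists e.
  by exists y.
by have [y Ay /eB By] := h _ e0; exists y.
Qed.

Lemma within_continuous_enormP A (f : V -> V) : {within A, continuous f} <->
  forall x, A x -> forall e, 0 < e -> exists2 r, 0 < r &
    forall y, A y -> enorm (y - x) < r -> enorm (f y - f x) < e.
Proof.
split=> [/subspace_continuousP h x Ax e e0|h].
  have /(h x Ax)/nbhs_enorm[r r0 hr] : nbhs (f x) [set y | enorm (y - f x) < e].
    by apply/nbhs_enorm; exists e.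
  by exists r => // y Ay /hr; apply.
apply/subspace_continuousP => x Ax B /nbhs_enorm[e e0 eB].
have [r r0 hr] := h x Ax e e0.
by apply/nbhs_enorm; exists r => // y yr Ay; exact/eB/hr.
Qed.

End EuclideanTopology.

(** * Translations and tiles *)

(** Serves to choose one separation, thickness or (as the inverse of a scale)
    radius for all members of a finite set. *)
Lemma finite_common_scale (R : realType) T (F : set T) (Q : T -> R -> Prop) :
  finite_set F -> (forall t e e', 0 < e' -> e' <= e -> Q t e -> Q t e') ->
  (forall t, F t -> exists2 e, 0 < e & Q t e) ->
  exists2 e, 0 < e & forall t, F t -> Q t e.
Proof.
elim/Pchoice: T => T in F Q *.
move=> /finite_seqP[s ->] mono; elim: s => [|t s ih] h; first by exists 1.
have [u us|e e0 he] := ih; first by apply: h; rewrite /= inE us orbT.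
have [e' e'0 he'] := h t (mem_head _ _).
have m0 : 0 < Num.min e e' by rewrite lt_min e0.
exists (Num.min e e') => // u /=; rewrite inE => /orP[/eqP ->|us].
  by apply: mono he' => //; rewrite ge_min lexx orbT.
by apply: mono (he u us) => //; rewrite ge_min lexx.
Qed.

Section Translation.
Variables (R : realType) (d : nat) (L : Type).
Local Notation V := ('rV[R]_d).
Local Notation tile := (tile R d L).
Implicit Types (x y z v w : V) (A : set V) (t u : tile) (P Q S : set tile).

Lemma mem_translate_tile x t z : (translate_tile x t).1 z <-> t.1 (z - x).
Proof.
split=> [[y ty <-]|tz]; first by rewrite addrK.
by exists (z - x); rewrite ?subrK.
Qed.

Lemma interior_translate_tile x t z : (translate_tile x t).1^° z <-> t.1^° (z - x).
Proof.
rewrite !interior_enormP; split=> -[e e0 he]; exists e => // y hy.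
  have /mem_translate_tile : (translate_tile x t).1 (y + x).
    by apply: he; rewrite -addrA -[x - z]opprB.
  by rewrite addrK.
by apply/mem_translate_tile; apply: he; rewrite opprB addrA subrK.
Qed.

Lemma is_tile_translate x t : is_tile t -> is_tile (translate_tile x t).
Proof.
move=> [[f [g [cf cg fA gf]]] tcl]; split.
  exists (fun z => f z + x), (fun z => g (z - x)); split.
  - move/within_continuous_enormP: cf => cf; apply/within_continuous_enormP.
    move=> z Az e /(cf z Az)[r r0 hr]; exists r => // y Ay yr.
    by rewrite opprD addrACA subrr addr0; exact: hr.
  - move/within_continuous_enormP: cg => cg; apply/within_continuous_enormP.
    move=> z /mem_translate_tile Az e /(cg _ Az)[r r0 hr]; exists r => // y.
    move=> /mem_translate_tile Ay yr; apply: hr => //.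
    by rewrite opprB addrA subrK.
  - rewrite [RHS]/= -fA; apply/seteqP; split=> z /=.
      by move=> [y hy <-]; exists (f y) => //; exists y.
    by move=> [_ [y hy <-] <-]; exists y.
  - by move=> z hz; rewrite addrK gf.
apply/seteqP; split=> z.
  move=> /closure_enormP h; apply/mem_translate_tile; rewrite -tcl.
  apply/closure_enormP => e /h[y /interior_translate_tile ty yz].
  by exists (y - x) => //; rewrite opprB addrA subrK.
move=> /mem_translate_tile; rewrite -[X in X (z - x)]tcl => /closure_enormP h.
apply/closure_enormP => e /h[y ty yz]; exists (y + x).
  by apply/interior_translate_tile; rewrite addrK.
by rewrite -addrA -[x - z]opprB.
Qed.

Lemma translate0 S : translate 0 S = S.
Proof. by apply/seteqP; split=> t; rewrite in_translate oppr0 translate_tile0. Qed.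

Lemma translateD x y S : translate x (translate y S) = translate (y + x) S.
Proof.
by apply/seteqP; split=> t; rewrite !in_translate translate_tileD opprD addrC.
Qed.

Lemma translate_subset x P S : P `<=` S -> translate x P `<=` translate x S.
Proof. exact: image_subset. Qed.

Lemma translate_subsetE x y P S :
  translate x P `<=` translate y S <-> translate (x - y) P `<=` S.
Proof.
split=> [/(translate_subset (x := - y))|/(translate_subset (x := y))].
  by rewrite !translateD subrr translate0.
by rewrite translateD subrK.
Qed.

Lemma supp_translate x P z : supp (translate x P) z <-> supp P (z - x).
Proof.
split=> [[_ [t Pt <-] /mem_translate_tile tz]|[t Pt tz]]; first by exists t.
by exists (translate_tile x t); [exists t|apply/mem_translate_tile].
Qed.

Lemma is_tiling_translate x S : is_tiling S -> is_tiling (translate x S).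
Proof.
move=> [tS cS dS lS]; split.
- by move=> _ [t St <-]; apply: is_tile_translate; exact: tS.
- by apply/seteqP; split=> // z _; apply/supp_translate; rewrite cS.
- move=> _ _ [t St <-] [u Su <-] tu; apply/seteqP; split=> // z.
  move=> [/interior_translate_tile tz /interior_translate_tile uz].
  have : (t.1^° `&` u.1^°) (z - x) by [].
  by rewrite dS// => e; apply: tu; rewrite e.
- move=> _ _ l [t St <-] [u Su <-] /= tl ul.
  have [y ->] := lS t u l St Su tl ul; exists y.
  by rewrite !translate_tileD addrC.
Qed.

Definition translate_tiling x (S : tiling R d L) : tiling R d L :=
  Tiling (is_tiling_translate x (tilingP S)).

(** A tile is the closure of its interior, so a second tile through an interior
    point of the first would overlap it in an open set. *)
Lemma tile_at_interior_point (S : tiling R d L) t u z :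
  tiles S t -> tiles S u -> t.1 z -> u.1^° z -> t = u.
Proof.
move=> St Su tz uz; apply: contrapT => tu.
have [tS _ dS _] := tilingP S; have [_ tcl] := tS t St.
move: tz; rewrite -[X in X z]tcl => /closure_enormP tz.
have /nbhs_enorm[e e0 he] : nbhs z u.1^° by exact: nbhs_interior.
have [y ty /he uy] := tz e e0.
have : (t.1^° `&` u.1^°) y by [].
by rewrite dS.
Qed.

Lemma tile_in_eball t : is_tile t -> exists r, t.1 `<=` eball 0 r.
Proof.
move=> [[f [g [cf _ <- _]]] _]; apply: compact_in_eball.
exact: continuous_compact cf (@compact_eball R d 1).
Qed.

Lemma tile_nonempty t : is_tile t -> t.1 !=set0.
Proof.
move=> [[f [g [_ _ <- _]]] _]; exists (f 0); exists 0 => //.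
by rewrite /eball/= subr0 enorm0.
Qed.

Lemma tile_interior_nonempty t : is_tile t -> t.1^° !=set0.
Proof.
move=> tt; have [z tz] := tile_nonempty tt; move: tz; rewrite -[X in X z]tt.2.
by move=> /closure_enormP/(_ 1 ltr01)[y ty _]; exists y.
Qed.

(** A tile invariant under a nonzero translation would be unbounded. *)
Lemma translate_tile_inj t : is_tile t -> injective (fun x => translate_tile x t).
Proof.
move=> tt x y e; have [r tr] := tile_in_eball tt; have [z tz] := tile_nonempty tt.
have shift w : t.1 w -> t.1 (w + (x - y)).
  move=> tw; have : (translate_tile x t).1 (w + x).
    by apply/mem_translate_tile; rewrite addrK.
  by rewrite e => /mem_translate_tile; rewrite addrA.
have iter n : t.1 (z + (x - y) *+ n).
  elim: n => [|n /shift]; first by rewrite mulr0n addr0.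
  by rewrite -addrA -mulrSr.
apply/eqP; rewrite -subr_eq0; apply/eqP/enorm_eq0/eqP.
rewrite eq_le enorm_ge0 andbT leNgt; apply/negP => v0.
have {}iter n : enorm (x - y) *+ n <= r + enorm z.
  rewrite -enormMn; have /tr := iter n; rewrite /eball/= subr0 => h.
  rewrite -[_ *+ n](addKr z) addrC.
  by apply: le_trans (enormB _ _) _; rewrite lerD2r.
have := iter (Num.truncn ((r + enorm z) / enorm (x - y))).+1.
apply/negP; rewrite -ltNge -mulr_natl -ltr_pdivrMr//.
exact: truncnS_gt.
Qed.

Lemma patch_in_eball S P : (forall t, S t -> is_tile t) -> is_patch S P ->
  exists2 r, 0 < r & supp P `<=` eball 0 r.
Proof.
move=> tS [finP _ PS].
have [||e e0 he] := @finite_common_scale R _ P (fun t e => t.1 `<=` eball 0 e^-1) finP.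
- move=> t e e' e'0 ee' te z /te; rewrite /eball/= => /le_trans; apply.
  by rewrite lef_pV2// posrE (lt_le_trans e'0).
- move=> t /PS/tS/tile_in_eball[r tr]; exists (Num.max r 1)^-1.
    by rewrite invr_gt0 lt_max ltr01 orbT.
  by rewrite invrK => z /tr; rewrite /eball/= le_max => ->.
by exists e^-1; [rewrite invr_gt0|move=> z [t /he]; apply].
Qed.

End Translation.

(** * The topology of the hull *)

Section Closeness.
Variables (R : realType) (d : nat) (L : Type).
Local Notation V := ('rV[R]_d).
Local Notation tile := (tile R d L).
Implicit Types (x y z v w : V) (t u : tile) (P Q S : set tile).

Lemma eps_close_sym e S S' : eps_close e S S' -> eps_close e S' S.
Proof. by move=> [x [y [hx hy h]]]; exists y, x; split=> // t /h h'; apply: iff_sym. Qed.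

(** By the size condition, the tiles of P shifted by at most e / 2 still lie in
    the ball on which the two shifted tilings agree. *)
Lemma eps_close_patch e r P S S' : P `<=` S -> supp P `<=` eball 0 r ->
  r + e / 2 <= e^-1 -> eps_close e S S' ->
  exists2 v, enorm v <= e & translate v P `<=` S'.
Proof.
move=> PS Pr re [x [y [hx hy h]]]; exists (x - y).
  apply: le_trans (enormB _ _) _; rewrite [leRHS](splitr e); exact: lerD.
apply/translate_subsetE => _ [t Pt <-]; apply/h; last by exists t => //; exact: PS.
move=> z /mem_translate_tile tz; have /Pr := ex_intro2 _ _ t Pt tz : supp P _.
rewrite /eball/= !subr0 => zr; rewrite -[z](subrK x).
apply: le_trans (enormD _ _) _; apply: le_trans re; exact: lerD.
Qed.

(** The translation is shared equally between the two tilings. *)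
Lemma eps_close_translate e S s s' : enorm (s' - s) <= e ->
  eps_close e (translate s S) (translate s' S).
Proof.
move=> ss'; have half (a : V) : enorm a <= e -> enorm (2^-1 *: a) <= e / 2.
  by rewrite enormZ ger0_norm ?invr_ge0// mulrC => ?; rewrite ler_pM2r.
exists (2^-1 *: (s' - s)), (2^-1 *: (s - s')); split.
- exact: half.
- by apply: half; rewrite enorm_distC.
- suff -> : translate (2^-1 *: (s' - s)) (translate s S) =
      translate (2^-1 *: (s - s')) (translate s' S) by [].
  rewrite !translateD; congr translate; apply/rowP => i; rewrite !mxE; lra.
Qed.

(** Provides the size condition of [eps_close_patch]. *)
Lemma small_scale (r e : R) : 0 < e ->
  exists2 e', 0 < e' & e' <= e /\ r + e' / 2 <= e'^-1.
Proof.
move=> e0; have m0 : 0 < Num.max r 1 + 1.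
  by rewrite ltr_wpDl// le_max ler01 orbT.
exists (Num.min (Num.min e 1) (Num.max r 1 + 1)^-1).
  by rewrite !lt_min e0 ltr01 invr_gt0.
set e' := Num.min _ _; have e'e : e' <= Num.min e 1 by rewrite ge_min lexx.
have e'0 : 0 < e' by rewrite !lt_min e0 ltr01 invr_gt0.
move: e'e; rewrite le_min => /andP[-> e'1]; split=> //.
have : (Num.max r 1 + 1) <= e'^-1.
  by rewrite -[leLHS]invrK lef_pV2 ?posrE ?invr_gt0// ge_min lexx orbT.
apply: le_trans; apply: lerD; first by rewrite le_max lexx.
by rewrite ler_pdivrMr// mul1r (le_trans e'1)// ler1n.
Qed.

Lemma nbhs_tilingP (S : tiling R d L) (A : set (tiling R d L)) :
  nbhs S A <-> exists2 e, 0 < e & forall S' : tiling R d L, eps_close e S S' -> A S'.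
Proof.
rewrite nbhsP; split=> [[E [e e0 eE] EA]|[e e0 eA]].
  by exists e => // S' h; apply: EA; apply/xsectionP; exact: eE.
exists [set ST : tiling R d L * tiling R d L | eps_close e ST.1 ST.2].
  by exists e.
by move=> S' /xsectionP; exact: eA.
Qed.

Variable T : tiling R d L.

Lemma hullP (S : hull T) e : 0 < e ->
  exists s, eps_close e (translate s T) (set_val S).
Proof.
move=> e0; have := set_valP S; rewrite /hull => /(_ [set S' | eps_close e (set_val S) S']).
case; first by apply/nbhs_tilingP; exists e.
by move=> _ [[s ->] h]; exists s; exact: eps_close_sym.
Qed.

Lemma translate_in_hull s : translate_tiling s T \in hull T.
Proof. by rewrite inE; apply: subset_closure; exists s. Qed.

Definition hull_translate s : hull T := SigSub (translate_in_hull s).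

Lemma open_hullP (A : set (hull T)) : open A <->
  forall S : hull T, A S -> exists2 e, 0 < e &
    forall S' : hull T, eps_close e (set_val S) (set_val S') -> A S'.
Proof.
split=> [[B oB <-] S BS|h].
  have /nbhs_tilingP[e e0 eB] : nbhs (set_val S) B by exact: open_nbhs_nbhs.
  by exists e => // S' /eB.
rewrite openE => S /h[e e0 eA].
have nS : nbhs (set_val S) [set S' : tiling R d L | eps_close e (set_val S) S'].
  by apply/nbhs_tilingP; exists e.
have /= := @initial_continuous _ _ (set_val : hull T -> tiling R d L) S _ nS.
move=> ne; rewrite /interior /=.
by apply: (@filterS _ (nbhs S) _ (set_val @^-1` [set S' : tiling R d L |
  eps_close e (set_val S) S'])) ne => S' /eA.
Qed.

End Closeness.

(** * Occurrences of a patch and finite local complexity *)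

Section Locations.
Variables (R : realType) (d : nat) (L : Type) (T : tiling R d L).
Local Notation V := ('rV[R]_d).
Local Notation tile := (tile R d L).
Implicit Types (x y z v w : V) (t u : tile) (P Q : set tile).

Let tileT t : tiles T t -> is_tile t.
Proof. by have [+ _ _ _] := tilingP T; apply. Qed.

Lemma patchU P Q : is_patch T P -> is_patch T Q -> is_patch T (P `|` Q).
Proof.
move=> [fP [t Pt] PT] [fQ _ QT]; split.
- by rewrite finite_setU.
- by exists t; left.
- by rewrite subUset.
Qed.

Lemma patch_translate P z : is_patch T P -> locations T P z -> is_patch T (translate z P).
Proof.
move=> [fP [t Pt] _] zT; split=> //; first exact: finite_image.
by exists (translate_tile z t), t.
Qed.

Lemma locations_translate (S : set tile) P s z :
  locations (translate s S) P z <-> locations S P (z - s).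
Proof. exact: translate_subsetE. Qed.

Lemma locations_finite P Q : is_patch T P -> finite_set Q -> finite_set (locations Q P).
Proof.
move=> [_ [t Pt] PT] fQ.
apply: sub_finite_set (finite_preimage _ fQ : finite_set ((fun z => translate_tile z t) @^-1` Q)).
  by move=> z /= zQ; apply: zQ; exists t.
by move=> x y _ _; exact/translate_tile_inj/tileT/PT.
Qed.

Hypothesis flcT : FLC T.

(** A return vector of length at most r is seen in the union of two occurrences
    of P, a patch of bounded diameter; there are finitely many such unions up to
    translation, and each contains finitely many occurrences of P. *)
Lemma return_vectors_locally_finite P r : is_patch T P ->
  finite_set (return_vectors T P `&` [set v | enorm v <= r]).
Proof.
move=> pP; have [r1 r1_gt0 Pr1] := patch_in_eball tileT pP.
have [|F [finF FP]] := flcT (r := r1 *+ 2 + `|r|).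
  by rewrite ltr_pwDl// mulrn_wgt0.
apply: (@sub_finite_set _ _ (\bigcup_(Q in F `&` [set Q | finite_set Q])
    ((fun p => p.1 - p.2) @` (locations Q P `*` locations Q P)))); last first.
  apply: bigcup_finite; first exact: finite_setIl.
  by move=> Q [_ fQ]; apply: finite_image; apply: finite_setX; exact: locations_finite.
move=> v [[x [y [xT yT ->]]] /= xyr].
pose Q := translate x P `|` translate y P.
have pQ : is_patch T Q by apply: patchU; exact: patch_translate.
have [|Q' FQ' [s QE]] := FP Q pQ.
  have shifted w z : supp (translate w P) z -> enorm (z - w) <= r1.
    by move=> /supp_translate/Pr1; rewrite /eball/= subr0.
  have diff w w' z z' : supp (translate w P) z -> supp (translate w' P) z' ->
      enorm (w - w') <= `|r| -> enorm (z - z') <= r1 *+ 2 + `|r|.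
    move=> /shifted h /shifted h' hw.
    rewrite (_ : z - z' = (z - w) - (z' - w') + (w - w')); last first.
      by apply/rowP => i; rewrite !mxE; ring.
    apply: le_trans (enormD _ _) _; apply: lerD => //.
    by apply: le_trans (enormB _ _) _; rewrite mulr2n lerD.
  have xyr' : enorm (x - y) <= `|r| by exact: le_trans (ler_norm r).
  have zr : enorm (0 : V) <= `|r| by rewrite enorm0.
  move=> z z' [t [Pt|Pt] tz] [t' [Pt'|Pt'] tz'].
  - by apply: (diff x x); [exists t|exists t'|rewrite subrr].
  - by apply: (diff x y); [exists t|exists t'|].
  - by apply: (diff y x); [exists t|exists t'|rewrite enorm_distC].
  - by apply: (diff y y); [exists t|exists t'|rewrite subrr].
have Q'E : Q' = translate (- s) Q by rewrite QE translateD subrr translate0.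
exists Q'; first by split=> //=; rewrite Q'E; apply: finite_image; case: pQ.
exists (x - s, y - s); last by rewrite /= opprB addrA subrK.
by split; apply/translate_subsetE; rewrite -QE => t Pt; [left|right].
Qed.

(** The tiles of bounded diameter have finitely many shapes up to translation,
    and each shape contains a ball. *)
Lemma tile_thickness r : 0 < r -> exists2 e, 0 < e &
  forall t, tiles T t -> diam_le r t.1 -> exists z, forall y, enorm (y - z) < e -> t.1 y.
Proof.
move=> r0; have [F [finF FP]] := flcT r0.
pose thick (Q : set tile) e := forall t, tiles T t ->
  (exists s, [set t] = translate s Q) -> exists z, forall y, enorm (y - z) < e -> t.1 y.
have [||e e0 he] := finite_common_scale (Q := thick) finF.
- move=> Q e e' _ ee' h t Tt /(h t Tt)[z hz]; exists z => y hy.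
  by apply: hz; exact: lt_le_trans ee'.
- move=> Q _; have [[t [Tt [s QE]]]|nQ] :=
      pselect (exists t, tiles T t /\ exists s, [set t] = translate s Q); last first.
    by exists 1 => // t Tt Qt; case: nQ; exists t.
  have [z /nbhs_enorm[e e0 he]] := tile_interior_nonempty (tileT Tt).
  exists e => // u _ [s' QE'].
  have : translate (s' - s) [set t] u.
    by rewrite QE translateD addrC subrK -QE'.
  move=> [_ -> <-]; exists (z + (s' - s)) => y hy; apply/mem_translate_tile.
  by apply: he; rewrite -addrA -opprD [_ + z]addrC.
exists e => // t Tt dt.
have [||Q FQ QE] := FP [set t]; [|by rewrite /supp bigcup_set1|exact: he QE].
by split; [exact: finite_set1|exists t|move=> _ ->].
Qed.

(** Infinitely many tiles may meet a ball, since FLC allows tiles of unbounded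
    diameter. The patch Q therefore consists of one tile through each point of a
    fine net of the ball of radius 1/e. A tile inside this ball is thick by
    [tile_thickness], so it has a net point in its interior and is the tile
    chosen there. *)
Lemma patch_forcing_closeness e : 0 < e -> exists2 Q, is_patch T Q &
  forall w, locations T Q w -> eps_close e T (translate (- w) T).
Proof.
move=> e0; have r0 : 0 < e^-1 *+ 2 by rewrite mulrn_wgt0// invr_gt0.
have [f f0 thick] := tile_thickness r0.
have [N finN Nnet] := @eball_net R d e^-1 f f0.
have /choice[tl tlP] : forall y, exists t, tiles T t /\ t.1 y.
  move=> y; have [_ cT _ _] := tilingP T.
  by have [t Tt ty] : supp T y by [rewrite cT]; exists t.
have N0 : exists y, N y.
  have [|y Ny _] := Nnet 0; last by exists y.
  by rewrite enorm0 invr_ge0 ltW.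
exists (tl @` N).
  split; first exact: finite_image.
    by have [y Ny] := N0; exists (tl y), y.
  by move=> _ [y _ <-]; exact: (tlP y).1.
move=> w wT; pose S := translate_tiling (- w) T.
have sub : tl @` N `<=` S.
  by rewrite -[tl @` N]translate0; apply/translate_subsetE; rewrite opprK add0r.
(* used for both tilings, T itself and S = T - w, which share the patch *)
have picked (S' : tiling R d L) u : tl @` N `<=` S' -> tiles S' u ->
    (exists s, tiles T (translate_tile s u)) -> u.1 `<=` eball 0 e^-1 -> (tl @` N) u.
  move=> NS' S'u [s Tu] ur.
  have [|z hz] := thick _ Tu.
    move=> x y /mem_translate_tile/ur + /mem_translate_tile/ur.
    rewrite /eball/= !subr0 => hx hy.
    rewrite -[x](subrK s) -[y](subrK s) opprD addrACA subrr addr0.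
    by apply: le_trans (enormB _ _) _; rewrite mulr2n lerD.
  have uz y : enorm (y - (z - s)) < f -> u.1 y.
    move=> hy; have /mem_translate_tile : (translate_tile s u).1 (y + s).
      by apply: hz; move: hy; rewrite opprB addrA.
    by rewrite addrK.
  have [|y Ny hy] := Nnet (z - s).
    have /ur : u.1 (z - s) by apply: uz; rewrite subrr enorm0.
    by rewrite /eball/= subr0.
  exists y => //; apply: (@tile_at_interior_point _ _ _ S' _ _ y) => //.
  - by apply: NS'; exists y.
  - exact: (tlP y).2.
  - apply/nbhs_enorm; exists (f - enorm (y - (z - s))).
      by rewrite subr_gt0 enorm_distC.
    move=> x; rewrite ltrBrDr => hx; apply: uz; apply: le_lt_trans hx.
    by apply: le_trans (enormD _ _); rewrite addrA subrK.
exists 0, 0; rewrite enorm0; split; [by rewrite divr_ge0// ltW|by rewrite divr_ge0// ltW|].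
move=> u ur; rewrite !translate0; split=> [Tu|Su].
- apply: sub; apply: (picked T) => //; last by exists 0; rewrite translate_tile0.
  by move=> _ [y _ <-]; exact: (tlP y).1.
- have [y _ <-] : (tl @` N) u; last exact: (tlP y).1.
  apply: (picked S) => //; exists w; move: Su; rewrite /S /= in_translate opprK.
  exact.
Qed.

End Locations.

(** * Return vectors of a patch *)

Section ReturnVectors.
Variables (R : realType) (d : nat) (L : Type) (T : tiling R d L).
Local Notation V := ('rV[R]_d).
Local Notation tile := (tile R d L).
Implicit Types (x y z v w : V) (t u : tile) (P Q : set tile).
Hypotheses (repT : repetitive T) (flcT : FLC T).

Let tileT t : tiles T t -> is_tile t.
Proof. by have [+ _ _ _] := tilingP T; apply. Qed.

Lemma patch_supp_nonempty P : is_patch T P -> supp P !=set0.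
Proof.
by move=> [_ [t Pt] /(_ t Pt)/tileT/tile_nonempty[q tq]]; exists q, t.
Qed.

Lemma supp_translate_eball P z r :
  supp P `<=` eball 0 r -> supp (translate z P) `<=` eball 0 (r + enorm z).
Proof.
move=> Pr q /supp_translate/Pr; rewrite /eball/= !subr0 => h.
by rewrite -[q](subrK z); apply: le_trans (enormD _ _) _; rewrite lerD2r.
Qed.

Lemma locations_relatively_dense P : is_patch T P -> exists2 r, 0 < r &
  forall c, exists2 z, locations T P z & enorm (z - c) <= r.
Proof.
move=> pP; have [r r0 hr] := repT pP; have [q Pq] := patch_supp_nonempty pP.
exists r => // c; have [z [zT zr]] := hr (c + q); exists z => //.
have /zr : supp (translate z P) (q + z) by apply/supp_translate; rewrite addrK.
by rewrite /eball/= [q + z]addrC opprD addrACA subrr addr0.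
Qed.

Lemma hull_locations_near_origin P : is_patch T P -> exists2 r, 0 < r &
  forall S : hull T, exists2 z, locations (set_val S) P z & enorm z <= r.
Proof.
move=> pP; have [r r0 dense] := locations_relatively_dense pP.
have [r1 _ Pr1] := patch_in_eball tileT pP.
have [e e0 [e1 re]] := small_scale (r1 + r) (@ltr01 R).
exists (r + 1) => [|S]; first by rewrite addr_gt0.
have [s hs] := hullP S e0; have [z zT zr] := dense (- s).
rewrite opprK in zr.
have [||v ve vS] := eps_close_patch (P := translate (z + s) P) _ _ re hs.
- by apply/translate_subsetE; rewrite addrK.
- apply: subset_trans (supp_translate_eball Pr1) _ => q; rewrite /eball/= => h.
  by apply: le_trans h _; rewrite lerD2l.
exists (z + s + v); first by rewrite /locations/= -translateD.
apply: le_trans (enormD _ _) _; apply: lerD => //; exact: le_trans e1.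
Qed.

(** A pair of occurrences in a tiling of the hull is a patch, so it is found in
    a translate of T with the same difference vector. *)
Lemma hull_return_vectors P (S : hull T) x y : is_patch T P ->
  locations (set_val S) P x -> locations (set_val S) P y ->
  return_vectors T P (x - y).
Proof.
move=> pP xS yS; have [r1 r10 Pr1] := patch_in_eball tileT pP.
have [e e0 [_ re]] := small_scale (r1 + (enorm x + enorm y)) (@ltr01 R).
have [s /eps_close_sym hs] := hullP S e0.
have [||v _ vS] := eps_close_patch (P := translate x P `|` translate y P) _ _ re hs.
- by rewrite subUset.
- move=> q [t [Pt|Pt] tq].
    have /(supp_translate_eball Pr1) : supp (translate x P) q by exists t.
    rewrite /eball/= => /le_trans; apply; rewrite lerD2l lerDl; exact: enorm_ge0.
  have /(supp_translate_eball Pr1) : supp (translate y P) q by exists t.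
  rewrite /eball/= => /le_trans; apply; rewrite lerD2l lerDr; exact: enorm_ge0.
exists (x + v - s), (y + v - s); split.
- apply/translate_subsetE; rewrite -translateD; apply: subset_trans vS.
  by apply: translate_subset => t; left.
- apply/translate_subsetE; rewrite -translateD; apply: subset_trans vS.
  by apply: translate_subset => t; right.
by apply/rowP => i; rewrite !mxE; ring.
Qed.

(** Any two occurrences are joined by a chain of occurrences along the segment
    between them, with steps of bounded length. *)
Lemma return_module_finitely_generated P : is_patch T P ->
  exists F, [/\ finite_set F, F `<=` return_vectors T P &
    return_vectors T P `<=` zspan F].
Proof.
move=> pP; have [r r0 dense] := locations_relatively_dense pP.
set F := return_vectors T P `&` [set v | enorm v <= r *+ 2 + 1].
exists F; split; [exact: return_vectors_locally_finite|by move=> v []|].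
have chain (n : nat) z c p : locations T P z -> enorm (c - z) <= n%:R ->
    locations T P p -> enorm (p - c) <= r -> zspan F (p - z).
  move=> zT; elim: n c p => [|n ih] c p cz pT pc.
    apply: sub_zspan; split; first by exists p, z.
    rewrite /= -[p](subrK c) -addrA; apply: le_trans (enormD _ _) _.
    by apply: le_trans (lerD pc cz) _; rewrite addr0 mulr2n; lra.
  (* the next to last point of the subdivision of the segment from z to c *)
  pose c' := z + (n%:R / n.+1%:R) *: (c - z).
  have n0 : 0 < n.+1%:R :> R by rewrite ltr0n.
  have [q qT qc'] := dense c'.
  have {}ih : zspan F (q - z).
    apply: ih qT qc'; rewrite /c' addrC addKr enormZ ger0_norm ?divr_ge0//.
    by rewrite mulrAC ler_pdivrMr// ler_wpM2l.
  have cc' : enorm (c - c') <= 1.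
    rewrite (_ : c - c' = n.+1%:R^-1 *: (c - z)); last first.
      have e : n.+1%:R^-1 = 1 - n%:R / n.+1%:R :> R.
        by rewrite -[X in X - _](divff (lt0r_neq0 n0)) -mulrBl -natrB// subSnn mul1r.
      by rewrite e scalerBl scale1r /c' opprD addrA.
    by rewrite enormZ ger0_norm ?invr_ge0 ?ler0n// mulrC ler_pdivrMr// mul1r.
  rewrite -[p](subrK q) -addrA; apply: zspanD ih; apply: sub_zspan.
  split; first by exists p, q.
  rewrite /= (_ : p - q = (p - c) + (c - c') - (q - c')); last first.
    by apply/rowP => i; rewrite !mxE; ring.
  apply: le_trans (enormB _ _) _; apply: le_trans (lerD (enormD _ _) (lexx _)) _.
  by rewrite mulr2n; have := lerD (lerD pc cc') qc'; lra.
move=> _ [p [z [pT zT ->]]].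
apply: (chain (Num.truncn (enorm (p - z))).+1 z p p) => //.
  exact/ltW/truncnS_gt.
by rewrite subrr enorm0 ltW.
Qed.

End ReturnVectors.

(** * The cohomology class of a functional on the return module *)

Lemma subr_exchange (G : zmodType) (a b c d : G) : a - b = c - d -> a - c = b - d.
Proof.
by move=> e; rewrite -[a](subrK b) e addrAC [c - d - c]addrAC subrr add0r addrC.
Qed.

Section OccurrenceCocycle.
Variables (R : realType) (d : nat) (L : Type) (T : tiling R d L).
Local Notation V := ('rV[R]_d).
Local Notation tile := (tile R d L).
Variables (P : set tile) (rho eps : R).
Implicit Types (x y z v w : V) (t u : tile) (A B : set (hull T)).

Definition chart x : set (hull T) :=
  [set S : hull T | exists2 z, locations (set_val S) P z & enorm (z - x) < eps].

Definition chart_cover : set (set (hull T)) :=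
  [set A | exists2 x, enorm x <= rho & A = chart x].

(** Different points may define the same chart, so a cochain, which is a function
    of charts, has to choose one. *)
Definition chart_center A : V := xget 0 [set x | enorm x <= rho /\ A = chart x].

(** The vector from the occurrence of P near the centre of A to the one near the
    centre of B, in any tiling that belongs to both; see [displacementE]. *)
Definition displacement A B : V := xget 0 [set v | exists (S : hull T) z z',
  [/\ locations (set_val S) P z /\ locations (set_val S) P z',
      enorm (z - chart_center A) < eps, enorm (z' - chart_center B) < eps &
      v = z' - z]].

Definition occurrence_cochain (phi : V -> int) A B : int := phi (displacement A B).

Hypotheses (repT : repetitive T) (flcT : FLC T) (patchP : is_patch T P).
Hypotheses (eps_gt0 : 0 < eps) (eps_le1 : eps <= 1).
Hypothesis dense : forall S : hull T,
  exists2 z, locations (set_val S) P z & enorm z <= rho.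
Hypothesis separated : forall v v', return_vectors T P v -> return_vectors T P v' ->
  enorm v <= rho *+ 2 + 2 -> enorm v' <= rho *+ 2 + 2 ->
  enorm (v - v') < eps *+ 4 -> v = v'.

Lemma chart_centerP A : chart_cover A ->
  enorm (chart_center A) <= rho /\ A = chart (chart_center A).
Proof.
by move=> [x xr AE]; rewrite /chart_center; case: xgetP => [y _ //|/(_ x)[]].
Qed.

Lemma chart_coverP A (S : hull T) : chart_cover A -> A S ->
  exists2 z, locations (set_val S) P z & enorm (z - chart_center A) < eps.
Proof. by move=> /chart_centerP[_ AE]; rewrite {1}AE. Qed.

Lemma chart_open x : open (chart x).
Proof.
apply/open_hullP => S [z zS zx].
have [tT _ _ _] := tilingP T; have [r1 _ Pr1] := patch_in_eball tT patchP.
have [|e e0 [e1 re]] := small_scale (e := (eps - enorm (z - x)) / 2) (r1 + enorm z).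
  by rewrite divr_gt0// subr_gt0.
exists e => // S' SS'.
have [|v ve vS'] := eps_close_patch zS _ re SS'; first exact: supp_translate_eball.
exists (z + v); first by rewrite /locations/= -translateD.
rewrite addrAC; apply: le_lt_trans (enormD _ _) _; rewrite -ltrBrDl.
by apply: le_lt_trans ve _; apply: le_lt_trans e1 _; rewrite ltr_pdivrMr//; lra.
Qed.

Lemma chart_open_cover : open_cover chart_cover.
Proof.
split=> [_ [x _ ->]|]; first exact: chart_open.
apply/seteqP; split=> // S _; have [z zS zr] := dense S.
by exists (chart z); [exists z|exists z => //; rewrite subrr enorm0].
Qed.

(** Short return vectors form a finite set, so a displacement known up to 4 eps
    is known exactly. *)
Lemma displacementE A B (S : hull T) z z' : chart_cover A -> chart_cover B ->
  locations (set_val S) P z -> locations (set_val S) P z' ->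
  enorm (z - chart_center A) < eps -> enorm (z' - chart_center B) < eps ->
  displacement A B = z' - z.
Proof.
move=> /chart_centerP[Ar _] /chart_centerP[Br _].
set a := chart_center A in Ar *; set b := chart_center B in Br *.
have short (S' : hull T) w w' : locations (set_val S') P w ->
    locations (set_val S') P w' -> enorm (w - a) < eps -> enorm (w' - b) < eps ->
    [/\ return_vectors T P (w' - w), enorm (w' - w) <= rho *+ 2 + 2 &
        enorm ((w' - w) - (b - a)) < eps *+ 2].
  move=> wS wS' wa wb.
  have near : enorm ((w' - w) - (b - a)) < eps *+ 2.
    rewrite (_ : w' - w - (b - a) = (w' - b) - (w - a)); last first.
      by apply/rowP => i; rewrite !mxE; ring.
    by apply: le_lt_trans (enormB _ _) _; rewrite mulr2n ltrD.
  split=> //; first exact: hull_return_vectors wS' wS.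
  rewrite -[w' - w](subrK (b - a)); apply: le_trans (enormD _ _) _.
  apply: le_trans (lerD (ltW near) (enormB b a)) _.
  by rewrite !mulr2n; move: Ar Br eps_le1; lra.
move=> zS zS' za zb; rewrite /displacement.
case: xgetP => [v _ [S' [w [w' [[wS wS'] wa wb ->]]]]|/(_ (z' - z))[]]; last first.
  by exists S, z, z'.
have [v1 s1 n1] := short _ _ _ wS wS' wa wb.
have [v2 s2 n2] := short _ _ _ zS zS' za zb.
apply: separated => //.
rewrite -[w' - w](subrK (b - a)) -addrA -[b - a - _]opprB.
apply: le_lt_trans (enormB _ _) _.
by move: n1 n2; rewrite !mulr2n !mulrS mulr0n; lra.
Qed.

Definition additive_on (G : set V) (phi : V -> int) :=
  forall x y, G x -> G y -> phi (x - y) = phi x - phi y.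

Variable phi : V -> int.
Hypothesis phiB : additive_on (zspan (return_vectors T P)) phi.

Let ret (S : hull T) x y : locations (set_val S) P x -> locations (set_val S) P y ->
  zspan (return_vectors T P) (x - y).
Proof. by move=> xS yS; apply: sub_zspan; exact: hull_return_vectors xS yS. Qed.

Lemma occurrence_cocycle : cocycle1 chart_cover (occurrence_cochain phi).
Proof.
move=> A B C UA UB UC [S [[AS BS] CS]].
have [a aS aA] := chart_coverP UA AS; have [b bS bB] := chart_coverP UB BS.
have [c cS cC] := chart_coverP UC CS.
rewrite /occurrence_cochain (displacementE UB UC bS cS bB cC).
rewrite (displacementE UA UC aS cS aA cC) (displacementE UA UB aS bS aA bB).
have -> : c - b = (c - a) - (b - a) by rewrite opprB addrA subrK.
by rewrite phiB; [ring|exact: ret cS aS|exact: ret bS aS].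
Qed.

(** For each s, choose a member A s of W containing T + s and the occurrence p s
    of P in T + s near the centre of the chart r (A s). Then p s - s is an
    occurrence of P in T, and phi (p s - s - z0) - h (A s) is locally constant
    in s, because the trivialised cocycle says how phi changes with A s. *)
Lemma occurrence_class_eq0 W r :
  open_cover W -> refinement W chart_cover r ->
  coboundary1 W (pullback r (occurrence_cochain phi)) ->
  exists Q, [/\ is_patch T Q,
    return_vectors T Q `<=` zspan (return_vectors T P) &
    forall g, zspan (return_vectors T Q) g -> phi g = 0].
Proof.
move=> [oW cW] ref [h hE]; pose tau := hull_translate T.
have /choice[Ap ApP] : forall s, exists Ap : set (hull T) * V,
    [/\ W Ap.1, Ap.1 (tau s), locations (translate s T) P Ap.2 &
        enorm (Ap.2 - chart_center (r Ap.1)) < eps].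
  move=> s; have [A WA As] : (\bigcup_(A in W) A) (tau s) by rewrite cW.
  have [UA Ar] := ref A WA; have [p pS pA] := chart_coverP UA (Ar _ As).
  by exists (A, p).
pose A s := (Ap s).1; pose p s := (Ap s).2.
have WA s : W (A s) by case: (ApP s).
have As s : A s (tau s) by case: (ApP s).
have ps s : locations (set_val (tau s)) P (p s) by case: (ApP s).
have pA s : enorm (p s - chart_center (r (A s))) < eps by case: (ApP s).
have UA s : chart_cover (r (A s)) by have [] := ref _ (WA s).
(* the coboundary evaluated on a tiling lying in both A s and A s' *)
have jump s s' q : A s (tau s') -> locations (translate s' T) P q ->
    enorm (q - chart_center (r (A s))) < eps ->
    phi (p s' - q) = h (A s') - h (A s).
  move=> ss' qs qA; rewrite -hE//; last by exists (tau s').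
  rewrite /pullback /occurrence_cochain.
  by rewrite (displacementE (S := tau s') (UA s) (UA s') qs (ps s') qA (pA s')).
pose z0 := p 0.
have z0T : locations T P z0 by have := ps 0; rewrite /= translate0.
have psT s : locations T P (p s - s) by apply/locations_translate; exact: ps.
have retT x y : locations T P x -> locations T P y ->
    zspan (return_vectors T P) (x - y).
  by move=> xT yT; apply: sub_zspan; exists x, y.
pose F s := phi (p s - s - z0) - h (A s).
have Fconst s : F s = F 0.
  apply: locally_constant_along_segments => {}s.
  have /open_hullP/(_ _ (As s))[e e0 eA] := oW _ (WA s).
  exists (Num.min e (eps - enorm (p s - chart_center (r (A s))))).
    by rewrite lt_min e0 subr_gt0 pA.
  move=> s'; rewrite lt_min ltrBrDl => /andP[ss' ss'2].
  pose q := p s + (s' - s).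
  have qs : locations (translate s' T) P q.
    by apply/locations_translate; rewrite /q addrA addrAC addrK; exact: psT.
  have qA : enorm (q - chart_center (r (A s))) < eps.
    by apply: le_lt_trans ss'2; rewrite /q addrAC; exact: enormD.
  have /jump/(_ qs qA) : A s (tau s').
    by apply: eA; apply: eps_close_translate; exact: ltW.
  have -> : p s' - q = (p s' - s' - z0) - (p s - s - z0).
    by apply/rowP => i; rewrite !mxE; ring.
  by rewrite phiB; [exact: subr_exchange|exact: retT|exact: retT].
have /open_hullP/(_ _ (As 0))[e e0 eA] := oW _ (WA 0).
have [Q0 pQ0 Q0e] := patch_forcing_closeness flcT e0.
(* Q0 brings T - w into A 0, and the copy of P at z0 keeps its place there *)
pose Q := Q0 `|` translate z0 P.
have QP w : locations T Q w -> locations T P (z0 + w).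
  by move=> wT; rewrite /locations/= -translateD => t Pt; apply: wT;
    move: Pt => [u Pu <-]; exists u => //; right.
have Qret x y : locations T Q x -> locations T Q y -> return_vectors T P (x - y).
  move=> /QP xT /QP yT; exists (z0 + x), (z0 + y); split=> //.
  by rewrite opprD addrACA subrr add0r.
have phi0 : phi 0 = 0 by rewrite -[0 in LHS]subr0 phiB ?subrr//; exact: zspan0.
have wret w : locations T Q w -> zspan (return_vectors T P) w.
  by move=> /QP wT; rewrite -[w](addKr z0) addrC; exact: retT.
have phiw w : locations T Q w -> phi w = 0.
  move=> wT; have wz0 : locations (translate (- w) T) P z0.
    by apply/locations_translate; rewrite opprK; exact: QP.
  have /jump/(_ wz0 (pA 0)) : A 0 (tau (- w)).
    apply: eA; rewrite /= translate0; apply: Q0e.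
    by move=> t Pt; apply: wT; move: Pt => [u Pu <-]; exists u => //; left.
  have -> : p (- w) - z0 = (p (- w) - (- w) - z0) - w.
    by apply/rowP => i; rewrite !mxE; ring.
  rewrite phiB; [|exact: retT|exact: wret] => /subr_exchange.
  have := Fconst (- w); rewrite /F subr0 subrr phi0 => ->.
  by move=> /addIr.
exists Q; split.
- by apply: patchU => //; exact: patch_translate.
- by move=> _ [x [y [xT yT ->]]]; apply: sub_zspan; exact: Qret.
suff h' : zspan (return_vectors T Q) `<=`
    [set g | zspan (return_vectors T P) g /\ phi g = 0] by move=> g /h'[].
apply: zspan_ind.
- by split; first exact: zspan0.
- move=> x y [xP x0] [yP y0]; split; first exact: zspanB.
  by rewrite phiB// x0 y0 subrr.
- move=> _ [x [y [xT yT ->]]]; split; first by apply: sub_zspan; exact: Qret.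
  by rewrite phiB ?phiw ?subrr//; exact: wret.
Qed.

End OccurrenceCocycle.

(** * Patches of minimal rank *)

Lemma zindep_rank_exists (V : zmodType) m (E : 'I_m -> V) G : zgenerates E G ->
  exists n, has_zindep G n /\ ~ has_zindep G n.+1.
Proof.
move=> EG; apply: contrapT => h.
have all_n n : has_zindep G n.
  elim: n => [|n ih]; first exact: has_zindep0.
  by apply: contrapT => nn; apply: h; exists n.
by have := zgenerates_bound EG (all_n m.+1); rewrite ltnn.
Qed.

Section ReturnModule.
Variables (R : realType) (d : nat) (L : Type) (T : tiling R d L).
Local Notation V := ('rV[R]_d).
Local Notation tile := (tile R d L).
Implicit Types (x y z v w : V) (t u : tile) (P Q : set tile).

(** By FLC the vectors concerned form a finite set. *)
Lemma return_vectors_separated P r : FLC T -> is_patch T P ->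
  exists2 e, 0 < e <= 1 & forall v v', return_vectors T P v -> return_vectors T P v' ->
    enorm v <= r -> enorm v' <= r -> enorm (v - v') < e *+ 4 -> v = v'.
Proof.
move=> flcT pP; have fY := return_vectors_locally_finite flcT r pP.
have [||e e0 he] := @finite_common_scale R (V * V) _
    (fun p e => enorm (p.1 - p.2) < e *+ 4 -> p.1 = p.2) (finite_setX fY fY).
- move=> p e e' _ ee' h pe; apply: h; apply: lt_le_trans pe _.
  by rewrite lerMn2r ee' orbT.
- move=> p _; have [->|/eqP pp] := pselect (p.1 = p.2); first by exists 1.
  have p0 : 0 < enorm (p.1 - p.2).
    rewrite lt_neqAle enorm_ge0 andbT eq_sym; apply: contra pp => /eqP/enorm_eq0.
    by move/eqP; rewrite subr_eq0.
  exists (enorm (p.1 - p.2) / 4); first by rewrite divr_gt0.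
  by rewrite -[_ *+ 4]mulr_natr divfK// ltxx.
exists (Num.min e 1); first by rewrite lt_min e0 ltr01 ge_min lexx orbT.
move=> v v' Rv Rv' vr vr' vv'; apply: (he (v, v')) => //=.
by apply: lt_le_trans vv' _; rewrite lerMn2r ge_min lexx orbT.
Qed.

Lemma locations_subpatch P Q x : translate x Q `<=` P ->
  return_vectors T P `<=` return_vectors T Q.
Proof.
move=> QP; have loc y : locations T P y -> locations T Q (x + y).
  move=> yT; rewrite /locations/= -translateD.
  exact: subset_trans (translate_subset QP) yT.
move=> _ [y [z [/loc yT /loc zT ->]]]; exists (x + y), (x + z); split=> //.
by rewrite opprD addrACA subrr add0r.
Qed.

(** An interior point of a tile of Q lies in some tile of P, which has to be the
    same tile of T. *)
Lemma subpatch_of_supp P Q : is_patch T P -> Q `<=` T -> supp Q `<=` supp P -> Q `<=` P.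
Proof.
move=> [_ _ PT] QT QP t Qt; have [tT _ _ _] := tilingP T.
have [z tz] := tile_interior_nonempty (tT _ (QT _ Qt)).
have [|u Pu uz] := QP z; first by exists t => //; exact: interior_subset tz.
by rewrite -(tile_at_interior_point (PT _ Pu) (QT _ Qt) uz tz).
Qed.

Lemma Ret_zindep P n : has_zindep [set: Ret T P] n ->
  has_zindep (zspan (return_vectors T P)) n.
Proof.
move=> [v [_ vi]]; exists (fun i => val (v i)); split.
  by move=> i; apply/zspanP; exact: valP.
move=> k e; apply: vi; apply: val_inj; rewrite /zcomb raddf_sum raddf0 -[RHS]e.
by apply: eq_bigr => i _; rewrite [LHS]raddfMz.
Qed.

Definition patch_rank P n := has_zindep (zspan (return_vectors T P)) n /\
  ~ has_zindep (zspan (return_vectors T P)) n.+1.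

Hypotheses (repT : repetitive T) (flcT : FLC T).

Lemma patch_rank_exists P : is_patch T P -> exists n, patch_rank P n.
Proof.
move=> pP; have [F [finF _ FR]] := return_module_finitely_generated repT flcT pP.
have [m [E hE]] := zspan_fin_generated finF FR.
exact: zindep_rank_exists hE.
Qed.

Lemma minimal_patch_rank : exists n P, [/\ is_patch T P, patch_rank P n &
  forall Q, is_patch T Q -> has_zindep (zspan (return_vectors T Q)) n].
Proof.
have [t Tt] : exists t, tiles T t.
  have [_ cT _ _] := tilingP T; have [t Tt _] : supp T 0 by rewrite cT.
  by exists t.
have pt : is_patch T [set t].
  by split; [exact: finite_set1|exists t|move=> _ ->].
pose M n := `[< exists P, is_patch T P /\ patch_rank P n >].
have exM : exists n, M n.
  by have [n hn] := patch_rank_exists pt; exists n; apply/asboolP; exists [set t].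
have [n /asboolP[P [pP Pn]] min_n] := ex_minnP exM.
exists n, P; split=> // Q pQ; have [m Qm] := patch_rank_exists pQ.
apply: has_zindep_leq Qm.1; apply: min_n; apply/asboolP.
by exists Q.
Qed.

(** If the combination psi of the coordinate functionals has trivial class, it
    vanishes on the return module of some patch Q. By minimality that subgroup
    has rank n, so it contains a nonzero multiple of each v j, where psi takes a
    nonzero multiple of the j-th coefficient as its value. *)
Lemma cech1_independent n P : is_patch T P -> patch_rank P n ->
  (forall Q, is_patch T Q -> has_zindep (zspan (return_vectors T Q)) n) ->
  has_zindep [set: cech1 (hull T)] n.
Proof.
move=> pP [[v [vP vi]] maxP] minP.
have [F [/finite_seqP[s ->] sR Rs]] := return_module_finitely_generated repT flcT pP.
have [|N N0 coord] := zspan_coordinates _ Rs vP vi maxP.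
  by move=> g gs; apply: sub_zspan; exact: sR.
have {coord}/choice[phi phiE] : forall g, exists k : 'I_n -> int,
    zspan (return_vectors T P) g -> g *~ N = zcomb v k.
  move=> g; have [gP|] := pselect (zspan (return_vectors T P) g).
    by have [k kE] := coord g gP; exists k.
  by exists (fun=> 0).
have phiB i : additive_on (zspan (return_vectors T P)) (fun g => phi g i).
  move=> x y xP yP; apply: (zindep_inj (k := phi (x - y)) (l := fun i => phi x i - phi y i) vi _ i).
  by rewrite zcombB -!phiE ?mulrzBl//; exact: zspanB.
have [rho rho0 dense] := hull_locations_near_origin repT pP.
have [eps /andP[eps0 eps1] sep] := return_vectors_separated (rho *+ 2 + 2) flcT pP.
have cover := chart_open_cover pP eps0 dense.
pose c i := occurrence_cochain (T := T) P rho eps (fun g => phi g i).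
have cc i : cocycle1 (chart_cover (T := T) P rho eps) (c i).
  exact: occurrence_cocycle.
exists (fun i => cech_class cover (c i)); split=> // k.
rewrite (cech_class_zcomb cover k cc) => e j.
pose psi g : int := \sum_i phi g i * k i.
have psiB : additive_on (zspan (return_vectors T P)) psi.
  move=> x y xP yP; rewrite /psi -sumrB; apply: eq_bigr => i _.
  by rewrite phiB// mulrBl.
have [W [r [cW ref cob]]] := cech_class_eq0
  (occurrence_cocycle pP eps1 sep psiB : cocycle1 _ (fun A B => \sum_i c i A B * k i)) e.
have [Q [pQ QP psi0]] := occurrence_class_eq0 flcT pP eps1 sep psiB cW ref cob.
have [w [wQ wi]] := minP Q pQ.
have wP i : zspan (return_vectors T P) (w i) by exact: zspan_mono QP _ (wQ i).
have [M M0 [l vM]] := zindep_maximal wP wi maxP (vP j).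
have phi_vM i : phi (v j *~ M) i = if i == j then M * N else 0.
  apply: (zindep_inj (k := phi (v j *~ M))
    (l := fun i => if i == j then M * N else 0) vi _ i).
  rewrite zcomb_delta -phiE ?mulrzA//.
  exact: zspanMz.
have : psi (v j *~ M) = 0 by apply: psi0; rewrite vM; exact: zspan_zcomb.
rewrite /psi (bigD1 j)//= big1 ?addr0 => [|i /negPf ij].
  by rewrite phi_vM eqxx => /eqP; rewrite !mulf_eq0 (negPf M0) (negPf N0) => /eqP.
by rewrite phi_vM ij mul0r.
Qed.

End ReturnModule.

Theorem theorem1 (R : realType) (d : nat) (L : Type) (T : tiling R d L) :
  aperiodic T -> repetitive T -> FLC T ->
  exists2 rho : R, 0 < rho &
    forall P : set (tile R d L), is_patch T P ->
      (exists c : 'rV[R]_d, eball c rho `<=` supp P) ->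
      rank_le (Ret T P) (cech1 (hull T)).
Proof.
move=> _ repT flcT; have [n [Q [pQ rQ minQ]]] := minimal_patch_rank repT flcT.
have [rho rho0 hrho] := repT Q pQ; exists rho => // P pP [c cP].
have [x [xT xc]] := hrho c.
have xP : translate x Q `<=` P.
  by apply: subpatch_of_supp pP xT _; exact: subset_trans xc cP.
apply: (@rank_le_criterion _ _ n); last exact: cech1_independent rQ minQ.
move=> /Ret_zindep[v [vP vi]]; apply: rQ.2; exists v; split=> // i.
apply: zspan_mono (vP i); apply: subset_trans (locations_subpatch xP) _.
exact: sub_zspan.
Qed.
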